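(* For a group $\Gamma$ and $n\in\mathbb{Z}$, let $\mathsf{I}^\Gamma_n$ be the class of all $\mathbb{Z}\Gamma$-chain complexes $X$ such that $H_j(\mathcal{N}\Gamma\otimes_{\mathbb{Z}\Gamma}X)=0$ for all $j\le n$. Then the family $(\mathsf{I}^\Gamma_n)_{\Gamma,n\in\mathbb{Z}}$, with $\Gamma$ ranging over all groups, is an equivariantly bootstrappable property of chain complexes over $\mathbb{Z}$. Moreover, this family satisfies axiom (B-res).
   Context: $\mathcal{N}\Gamma$ denotes the group von Neumann algebra of $\Gamma$ (the weak closure of $\mathbb{C}\Gamma$ in $B(\ell^2\Gamma)$). Chain complexes are $\mathbb{Z}$-graded complexes of left modules; $X$ is concentrated in degrees $\ge n$ if $X_j=0$ for all $j<n$. The suspension is $(\Sigma X)_j=X_{j-1}$, $\partial^{\Sigma X}_j=-\partial^X_{j-1}$. For a chain map $f\colon X\to Y$, $\mathrm{Cone}(f)_j=X_{j-1}\oplus Y_j$ with $\partial_j(x,y)=(-\partial^X_{j-1}(x),\partial^Y_j(y)+f_{j-1}(x))$. A family $(\mathsf{B}^\Gamma_n)_{\Gamma,n\in\mathbb{Z}}$, with $\Gamma$ ranging over all groups and $\mathsf{B}^\Gamma_n$ a class of $\mathbb{Z}\Gamma$-chain complexes closed under isomorphisms, is an equivariantly bootstrappable property of chain complexes over $\mathbb{Z}$ if for all groups $\Gamma$, all $n\in\mathbb{Z}$ and all $\mathbb{Z}\Gamma$-chain complexes $X,Y$: (B-deg) if $X$ is concentrated in degrees $\ge0$, then $X\in\mathsf{B}^\Gamma_m$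 for all $m<0$; (B-susp) $X\in\mathsf{B}^\Gamma_n$ if and only if $\Sigma X\in\mathsf{B}^\Gamma_{n+1}$; (B-cone) if $f\colon X\to Y$ is a $\mathbb{Z}\Gamma$-chain map, $X\in\mathsf{B}^\Gamma_{n-1}$ and $Y\in\mathsf{B}^\Gamma_n$, then $\mathrm{Cone}(f)\in\mathsf{B}^\Gamma_n$; (B-ind) if $\Delta\le\Gamma$ and $Z\in\mathsf{B}^\Delta_n$, then $\mathbb{Z}\Gamma\otimes_{\mathbb{Z}\Delta}Z\in\mathsf{B}^\Gamma_n$. Axiom (B-res): for every finite index subgroup $\Delta\le\Gamma$ and all $n\in\mathbb{Z}$, if $X\in\mathsf{B}^\Gamma_n$, then $\mathrm{res}^\Gamma_\Delta X\in\mathsf{B}^\Delta_n$. *)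

(* Defs.v *)
From HB Require Import structures.
From mathcomp Require Import all_boot all_order all_algebra finmap.
From mathcomp Require Import boolp classical_sets functions cardinality fsbigop.
From mathcomp Require Import reals ereal esum numfun.
From mathcomp Require Import complex ring lra.
(* The notations of monalg clash with those of classical_sets. *)
From mathcomp Require Import -(notations) monalg.

Set Implicit Arguments.
Unset Strict Implicit.
Unset Printing Implicit Defensive.
Import Order.TTheory GRing.Theory Num.Theory.

Local Open Scope ring_scope.

Lemma malg_bilinA (K : zmodType) (G : choiceType)
    (op : malg G K -> malg G K -> malg G K) :
  left_distributive op +%R -> right_distributive op +%R ->
  left_zero 0 op -> right_zero 0 op ->
  (forall g h k x y z,
     op (mkmalgU g x) (op (mkmalgU h y) (mkmalgU k z)) =
     op (op (mkmalgU g x) (mkmalgU h y)) (mkmalgU k z)) ->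
  associative op.
Proof.
move=> opDl opDr op0 opr0 opU a b c.
have suml I (r : seq I) F d : op (\sum_(i <- r) F i) d = \sum_(i <- r) op (F i) d.
  exact: (big_morph (op^~ d) (fun x y => opDl x y d) (op0 d)).
have sumr I (r : seq I) F d : op d (\sum_(i <- r) F i) = \sum_(i <- r) op d (F i).
  exact: (big_morph (op d) (opDr d) (opr0 d)).
rewrite (monalgE a) !suml; apply: eq_bigr => g _.
rewrite (monalgE b) suml !sumr suml; apply: eq_bigr => h _.
by rewrite (monalgE c) !sumr; apply: eq_bigr => k _.
Qed.

Section GroupRing.
Variables (K : nzRingType) (G : groupType).

(* malg G K is the type of finitely supported functions G -> K; monalg only
   gives it a ring structure for monoids whose sole unit is 1. *)
Definition grpring := malg G K.

HB.instance Definition _ := GRing.Lmodule.on grpring.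

Implicit Types (a b c : grpring) (g h : G).

Definition gr_unit g : grpring := mkmalgU g 1.

Definition gr_one : grpring := gr_unit 1%g.

Definition gr_mul a b : grpring :=
  \sum_(g <- msupp a) \sum_(h <- msupp b)
     mkmalgU (g * h)%g (mcoeff g a * mcoeff h b).

Let gr_mulw (d1 d2 : {fset G}) a b :
  (msupp a `<=` d1)%fset -> (msupp b `<=` d2)%fset ->
  gr_mul a b = \sum_(g <- d1) \sum_(h <- d2)
     mkmalgU (g * h)%g (mcoeff g a * mcoeff h b).
Proof.
move=> le1 le2; rewrite /gr_mul (big_fset_incl _ le1) /=.
  apply/eq_bigr=> k1 _; apply/big_fset_incl => // k _ /mcoeff_outdom ->.
  by rewrite mulr0 monalgU0.
move=> k _ /mcoeff_outdom g1k.
by rewrite big1 => // k' _; rewrite g1k mul0r monalgU0.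
Qed.

Let gr_mulUU (x y : K) g h :
  gr_mul (mkmalgU g x) (mkmalgU h y) = mkmalgU (g * h)%g (x * y).
Proof. by rewrite (gr_mulw msuppU_le msuppU_le) !big_seq_fset1 !mcoeffUU. Qed.

Let gr_mulDl : left_distributive gr_mul +%R.
Proof.
move=> a b c; rewrite (gr_mulw (msuppD_le a b) (fsubset_refl (msupp c))).
rewrite (gr_mulw (fsubsetUl _ (msupp b)) (fsubset_refl (msupp c))).
rewrite (gr_mulw (fsubsetUr (msupp a) _) (fsubset_refl (msupp c))).
rewrite -big_split /=; apply/eq_bigr=> k1 _.
rewrite -big_split /=; apply/eq_bigr=> k2 _.
by rewrite mcoeffD mulrDl monalgUD.
Qed.

Let gr_mulDr : right_distributive gr_mul +%R.
Proof.
move=> c a b; rewrite (gr_mulw (fsubset_refl (msupp c)) (msuppD_le a b)).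
rewrite (gr_mulw (fsubset_refl (msupp c)) (fsubsetUl _ (msupp b))).
rewrite (gr_mulw (fsubset_refl (msupp c)) (fsubsetUr (msupp a) _)).
rewrite -big_split /=; apply/eq_bigr=> k1 _.
rewrite -big_split /=; apply/eq_bigr=> k2 _.
by rewrite mcoeffD mulrDr monalgUD.
Qed.

Let gr_mul0 a : gr_mul 0 a = 0.
Proof. by rewrite /gr_mul msupp0 big_seq_fset0. Qed.

Let gr_mulr0 a : gr_mul a 0 = 0.
Proof. by rewrite /gr_mul msupp0 big1// => g _; rewrite big_seq_fset0. Qed.

Let gr_mulA : associative gr_mul.
Proof.
apply: malg_bilinA gr_mulDl gr_mulDr gr_mul0 gr_mulr0 _ => g h k x y z.
by rewrite !gr_mulUU mulrA mulgA.
Qed.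

Let gr_mul1 : left_id gr_one gr_mul.
Proof.
move=> a; rewrite [RHS]monalgE /gr_one /gr_unit.
rewrite (gr_mulw msuppU_le (fsubset_refl (msupp a))) big_seq_fset1.
by apply: eq_bigr => g _; rewrite mcoeffUU mul1r mul1g.
Qed.

Let gr_mulr1 : right_id gr_one gr_mul.
Proof.
move=> a; rewrite [RHS]monalgE /gr_one /gr_unit.
rewrite (gr_mulw (fsubset_refl (msupp a)) msuppU_le).
by apply: eq_bigr => g _; rewrite big_seq_fset1 mcoeffUU mulr1 mulg1.
Qed.

Let gr_one_neq0 : gr_one != 0.
Proof.
by apply/eqP => /(congr1 (mcoeff 1%g)) /eqP; rewrite mcoeffUU mcoeff0 oner_eq0.
Qed.

HB.instance Definition _ := GRing.Zmodule_isNzRing.Build grpring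
  gr_mulA gr_mul1 gr_mulr1 gr_mulDl gr_mulDr gr_one_neq0.

Lemma gr_mulE a b : a * b = \sum_(g <- msupp a) \sum_(h <- msupp b)
     mkmalgU (g * h)%g (mcoeff g a * mcoeff h b) :> grpring.
Proof. by []. Qed.

Lemma gr_mkmalgUM (x y : K) g h :
  (mkmalgU g x : grpring) * mkmalgU h y = mkmalgU (g * h)%g (x * y).
Proof. exact: gr_mulUU. Qed.

Lemma gr_unit1 : gr_unit 1%g = 1.
Proof. by []. Qed.

Lemma gr_unitM : {morph gr_unit : g h / (g * h)%g >-> g * h}.
Proof. by move=> g h; rewrite gr_mkmalgUM mulr1. Qed.

End GroupRing.

(* The ring morphism K[G] -> S determined by f : K -> S and u : G -> S. *)
Section GroupRingLift.
Variables (K : nzRingType) (G : groupType) (S : pzRingType).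

Definition gr_lift (f : K -> S) (u : G -> S) (a : grpring K G) : S :=
  \sum_(g <- msupp a) f (mcoeff g a) * u g.

Variables (f : {rmorphism K -> S}) (u : G -> S).

Let gr_liftw (d : {fset G}) a : (msupp a `<=` d)%fset ->
  gr_lift f u a = \sum_(g <- d) f (mcoeff g a) * u g.
Proof.
move=> le; rewrite /gr_lift (big_fset_incl _ le) //= => x xd /mcoeff_outdom ->.
by rewrite raddf0 mul0r.
Qed.

Lemma gr_liftU g x : gr_lift f u (mkmalgU g x) = f x * u g.
Proof. by rewrite (gr_liftw msuppU_le) big_seq_fset1 mcoeffUU. Qed.

Lemma gr_liftB : zmod_morphism (gr_lift f u).
Proof.
move=> a b; rewrite (gr_liftw (msuppB_le a b)).
rewrite (gr_liftw (fsubsetUl _ (msupp b))) (gr_liftw (fsubsetUr (msupp a) _)).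
by rewrite -sumrB; apply: eq_bigr => g _; rewrite mcoeffB raddfB mulrBl.
Qed.

Hypotheses (u1 : u 1%g = 1) (uM : {morph u : g h / (g * h)%g >-> g * h}).
Hypothesis fuC : forall x g, f x * u g = u g * f x.

Lemma gr_liftM : monoid_morphism (gr_lift f u).
Proof.
have lift_sum I r (F : I -> grpring K G) :
    gr_lift f u (\sum_(i <- r) F i) = \sum_(i <- r) gr_lift f u (F i).
  have l0 : gr_lift f u 0 = 0 by rewrite /gr_lift msupp0 big_seq_fset0.
  apply: (big_morph _ _ l0) => a b; have := gr_liftB a (- b).
  by rewrite opprK => ->; have := gr_liftB 0 b; rewrite l0 !sub0r => ->; rewrite opprK.
split; first by rewrite -gr_unit1 gr_liftU rmorph1 u1 mul1r.
move=> a b; rewrite (monalgE a) (monalgE b) mulr_suml !lift_sum mulr_suml.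
apply: eq_bigr => g _; rewrite !mulr_sumr lift_sum; apply: eq_bigr => h _.
rewrite gr_mkmalgUM !gr_liftU rmorphM uM !mulrA; congr (_ * _).
by rewrite -!mulrA; congr (_ * _); rewrite fuC.
Qed.

End GroupRingLift.

Section SubgroupMap.
Variables (G : groupType) (S : pred G) (D : subGroupType S).

(* The inclusion Z[D] -> Z[G] for a subgroup D of G. *)
Definition gr_incl : grpring int D -> grpring int G :=
  gr_lift intr (fun d => gr_unit int (val d)).

Let gr_inclB : zmod_morphism gr_incl.
Proof. exact: gr_liftB. Qed.

Let gr_inclM : monoid_morphism gr_incl.
Proof.
apply: gr_liftM.
- by rewrite val1 gr_unit1.
- by move=> g h; rewrite valM gr_unitM.
- by move=> x g; apply: commr_sym; apply: commr_int.
Qed.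

HB.instance Definition _ := GRing.isZmodMorphism.Build _ _ gr_incl gr_inclB.
HB.instance Definition _ := GRing.isMonoidMorphism.Build _ _ gr_incl gr_inclM.

End SubgroupMap.

Section Sums.
Variables (R : realType) (I : choiceType).
Implicit Types (a b : I -> R) (x y : I -> R[i]).

(* The sum of an absolutely summable family, as the difference of the sums of
   its positive and negative parts. *)
Definition rsum a : R :=
  fine (\esum_(i in [set: I]) ((EFin \o a)^\+ i)%E -
        \esum_(i in [set: I]) ((EFin \o a)^\- i)%E)%E.

Definition csum x : R[i] :=
  Complex (rsum (fun i => complex.Re (x i))) (rsum (fun i => complex.Im (x i))).

Definition rsummable a := summable [set: I] (EFin \o a).

Definition csummable x :=
  rsummable (fun i => complex.Re (x i)) /\ rsummable (fun i => complex.Im (x i)).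

Let S a : \bar R := \esum_(i in [set: I]) (a i)%:E.

Let S_ge0 a : (forall i, 0 <= a i) -> (0 <= S a)%E.
Proof. by move=> a0; apply: esum_ge0 => i _; rewrite lee_fin. Qed.

Let summableS a : (forall i, 0 <= a i) -> rsummable a = (S a < +oo)%E.
Proof.
move=> a0; rewrite /rsummable /summable; congr (_ < _)%E.
by apply: eq_esum => i _; rewrite /= ger0_norm.
Qed.

Let S_fin a : (forall i, 0 <= a i) -> rsummable a -> S a \is a fin_num.
Proof. by move=> a0; rewrite summableS// => ?; rewrite ge0_fin_numE ?S_ge0. Qed.

Lemma le_rsummable a b : (forall i, `|a i| <= b i) -> (S b < +oo)%E ->
  rsummable a.
Proof.
move=> ab; apply: le_lt_trans; apply: le_esum => i _.
by rewrite /= lee_fin.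
Qed.

Lemma esumZ_fin (c : R) a : 0 <= c -> (forall i, 0 <= a i) ->
  S (fun i => c * a i) = (c%:E * S a)%E.
Proof.
have le (d : R) (b : I -> R) : 0 <= d -> (forall i, 0 <= b i) ->
    (S (fun i => (d * b i)%R) <= d%:E * S b)%E.
  move=> d0 b0; apply: ge_ereal_sup => _ [X [finX _] <-].
  rewrite (eq_fsbigr (fun i => d%:E * (b i)%:E)%E); last first.
    by move=> i _; rewrite EFinM.
  rewrite -ge0_mule_fsumr; last by move=> i; rewrite lee_fin.
  apply: lee_wpmul2l; first by rewrite lee_fin.
  by apply: ereal_sup_ubound; exists X.
move=> c0 a0; have [->|cN0] := eqVneq c 0.
  by rewrite mul0e; apply: esum1 => i _; rewrite mul0r.
apply/eqP; rewrite eq_le le//=.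
have c'0 : 0 <= c^-1 by rewrite invr_ge0.
have ca0 i : 0 <= c * a i by rewrite mulr_ge0.
have /(lee_wpmul2l (_ : (0 <= c%:E)%E)) := le _ _ c'0 ca0.
rewrite muleA -EFinM divff// mul1e; under eq_fun do rewrite mulrA mulVf// mul1r.
by apply; rewrite lee_fin.
Qed.

Let rsum_diff a b : (forall i, 0 <= a i) -> (forall i, 0 <= b i) ->
  rsummable a -> rsummable b ->
  rsum (fun i => a i - b i) = fine (S a) - fine (S b).
Proof.
move=> a0 b0 sa sb; rewrite -fineB ?S_fin//; congr fine.
rewrite -(esumB sa sb); last 2 first.
- by move=> i _; rewrite lee_fin.
- by move=> i _; rewrite lee_fin.
by congr (esum _ _ - esum _ _)%E; congr numfun.funepos.body || congr numfun.funeneg.body.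
Qed.

Let pos a i := Num.max (a i) 0.
Let neg a i := Num.max (- a i) 0.

Let pos0 a i : 0 <= pos a i. Proof. by rewrite le_max lexx orbT. Qed.
Let neg0 a i : 0 <= neg a i. Proof. by rewrite le_max lexx orbT. Qed.
Let posneg a i : a i = pos a i - neg a i.
Proof. by rewrite /pos /neg; case: (ltgtP (a i) 0); case: (ltgtP (- a i) 0); lra. Qed.
Let rsummable_pos a : rsummable a -> rsummable (pos a).
Proof.
apply: le_lt_trans; apply: le_esum => i _ /=; rewrite lee_fin ger0_norm//.
by rewrite ge_max normr_ge0 ler_norm.
Qed.
Let rsummable_neg a : rsummable a -> rsummable (neg a).
Proof.
apply: le_lt_trans; apply: le_esum => i _ /=; rewrite lee_fin ger0_norm//.
by rewrite ge_max normr_ge0 -normrN ler_norm.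
Qed.

Let SD a b : (forall i, 0 <= a i) -> (forall i, 0 <= b i) ->
  S (fun i => a i + b i) = (S a + S b)%E.
Proof. by move=> a0 b0; rewrite /S -esumD//; move=> i _; rewrite lee_fin. Qed.

Lemma rsummableD a b : rsummable a -> rsummable b ->
  rsummable (fun i => a i + b i).
Proof. exact: summableD. Qed.

Lemma rsumD a b : rsummable a -> rsummable b ->
  rsum (fun i => a i + b i) = rsum a + rsum b.
Proof.
move=> sa sb.
have [pa na pb nb] := And4 (rsummable_pos sa) (rsummable_neg sa)
  (rsummable_pos sb) (rsummable_neg sb).
have -> : (fun i => a i + b i) =
    (fun i => (pos a i + pos b i) - (neg a i + neg b i)).
  by apply/funext => i; rewrite [a i]posneg [b i]posneg addrACA opprD.
have -> : rsum a = fine (S (pos a)) - fine (S (neg a)).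
  by rewrite -rsum_diff//; congr rsum; apply/funext => i.
have -> : rsum b = fine (S (pos b)) - fine (S (neg b)).
  by rewrite -rsum_diff//; congr rsum; apply/funext => i.
rewrite rsum_diff; [|by move=> i; rewrite addr_ge0|by move=> i; rewrite addr_ge0|exact: rsummableD|exact: rsummableD].
by rewrite !SD// !fineD ?S_fin//; ring.
Qed.

Lemma csumD x y : csummable x -> csummable y ->
  csum (fun i => x i + y i) = csum x + csum y.
Proof.
move=> [xr xi] [yr yi]; rewrite /csum -[RHS]/(Complex _ _) -!rsumD//.
by congr Complex; congr rsum; apply/funext => i; case: (x i) (y i) => ? ? [].
Qed.

End Sums.

Section L2.
Variables (R : realType) (G : groupType).
Local Notation C := (R[i]).
Local Notation normc := (@Normc.normc R).

Definition sqnorm (x : G -> C) : \bar R :=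
  \esum_(g in [set: G]) (normc (x g) ^+ 2)%:E.

Definition l2_pred : pred (G -> C) := fun x => `[< (sqnorm x < +oo)%E >].

Record l2 := L2 { l2val :> G -> C; l2P : l2_pred l2val }.

HB.instance Definition _ := [isSub for l2val].
HB.instance Definition _ := [Choice of l2 by <:].

Lemma sqr_normc (z : C) : normc z ^+ 2 = complex.Re z ^+ 2 + complex.Im z ^+ 2.
Proof. by case: z => a b /=; rewrite sqr_sqrtr// addr_ge0 ?sqr_ge0. Qed.

Lemma sqr_normcD (z w : C) :
  normc (z + w) ^+ 2 <= 2 * normc z ^+ 2 + 2 * normc w ^+ 2.
Proof.
rewrite !sqr_normc; case: z w => a b [c d] /=.
have := sqr_ge0 (a - c); have := sqr_ge0 (b - d); rewrite !expr2; nra.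
Qed.

Lemma sqnorm_ge0 x : (0 <= sqnorm x)%E.
Proof. by apply: esum_ge0 => g _; rewrite lee_fin sqr_ge0. Qed.

Lemma sqnormZ (c : C) x : sqnorm (c *: x) = ((normc c ^+ 2)%:E * sqnorm x)%E.
Proof.
rewrite /sqnorm -esumZ_fin ?sqr_ge0//; last by move=> i; rewrite sqr_ge0.
by apply: eq_esum => g _; rewrite /= Normc.normcM exprMn.
Qed.

Lemma sqnormD x y : (sqnorm (x + y)%R <= 2%:E * sqnorm x + 2%:E * sqnorm y)%E.
Proof.
rewrite /sqnorm -!esumZ_fin//; try by move=> i; rewrite sqr_ge0.
rewrite -esumD; try by move=> i _; rewrite lee_fin mulr_ge0// sqr_ge0.
by apply: le_esum => g _; rewrite -EFinD lee_fin; exact: sqr_normcD.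
Qed.

Fact l2_submod : submod_closed l2_pred.
Proof.
split=> [|c x y /asboolP x2 /asboolP y2].
  apply/asboolP; rewrite /sqnorm esum1 ?ltry// => g _.
  by rewrite sqr_normc /= expr0n addr0.
apply/asboolP; apply: le_lt_trans (sqnormD _ _) _; rewrite sqnormZ.
have fx : sqnorm x \is a fin_num by rewrite ge0_fin_numE ?sqnorm_ge0.
have fy : sqnorm y \is a fin_num by rewrite ge0_fin_numE ?sqnorm_ge0.
by rewrite -(fineK fx) -(fineK fy) -!EFinM -EFinD ltry.
Qed.

HB.instance Definition _ := GRing.SubChoice_isSubLmodule.Build C (G -> C) l2_pred l2
  (GRing.submod_closed_semi l2_submod).

Definition l2norm (x : l2) : R := Num.sqrt (fine (sqnorm x)).

(* Linear in the first variable. *)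
Definition inner (x y : l2) : C := csum (fun g => x g * conjc (y g)).

Lemma l2_lt_pinfty (x : l2) : (sqnorm x < +oo)%E.
Proof. by apply/asboolP; case: x. Qed.

Lemma l2norm_ge0 x : 0 <= l2norm x.
Proof. exact: sqrtr_ge0. Qed.

Lemma sqr_l2norm x : (l2norm x ^+ 2)%:E = sqnorm x.
Proof.
rewrite sqr_sqrtr ?fineK// ?fine_ge0 ?sqnorm_ge0//.
by rewrite ge0_fin_numE ?sqnorm_ge0// l2_lt_pinfty.
Qed.

Lemma l2normZ (c : C) x : l2norm (c *: x) = normc c * l2norm x.
Proof.
apply/eqP; rewrite -(@eqrXn2 _ 2)// ?mulr_ge0 ?l2norm_ge0//; last first.
  by case: (c) => a b; exact: sqrtr_ge0.
by rewrite exprMn -eqe [eqbRHS]EFinM !sqr_l2norm sqnormZ.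
Qed.

Lemma l2norm_crudeD x y : l2norm (x + y) <= 2 * (l2norm x + l2norm y).
Proof.
have x0 := l2norm_ge0 x; have y0 := l2norm_ge0 y; have xy0 := l2norm_ge0 (x + y).
rewrite -(@ler_pXn2r _ 2)// ?nnegrE ?mulr_ge0 ?addr_ge0//.
have : l2norm (x + y) ^+ 2 <= 2 * l2norm x ^+ 2 + 2 * l2norm y ^+ 2.
  by rewrite -lee_fin EFinD (EFinM 2) (EFinM 2) !sqr_l2norm; exact: sqnormD.
by move/le_trans; apply; rewrite !expr2; nra.
Qed.

Lemma csummable_inner (x y : l2) : csummable (fun g => x g * conjc (y g)).
Proof.
have S : (\esum_(g in [set: G]) (normc (x g) ^+ 2 + normc (y g) ^+ 2)%:E < +oo)%E.
  under eq_esum do rewrite EFinD.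
  rewrite esumD; try by move=> *; rewrite lee_fin sqr_ge0.
  by apply: lte_add_pinfty; exact: l2_lt_pinfty.
split; apply: le_rsummable S => g; rewrite !sqr_normc; case: (x g) (y g) => a b [c d] /=;
  rewrite ler_norml; apply/andP; split;
  have := sqr_ge0 (a + c); have := sqr_ge0 (a - c); have := sqr_ge0 (b + d);
  have := sqr_ge0 (b - d); have := sqr_ge0 (a + d); have := sqr_ge0 (a - d);
  have := sqr_ge0 (b + c); have := sqr_ge0 (b - c); rewrite !expr2; nra.
Qed.

Lemma innerDl x x' y : inner (x + x') y = inner x y + inner x' y.
Proof.
rewrite /inner -csumD; [|exact: csummable_inner|exact: csummable_inner].
by congr csum; apply/funext => g; rewrite /= -mulrDl.
Qed.

Lemma inner0l y : inner 0 y = 0.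
Proof. by apply: (addrI (inner 0 y)); rewrite -innerDl !addr0. Qed.

Lemma innerNl x y : inner (- x) y = - inner x y.
Proof. by apply: (addrI (inner x y)); rewrite -innerDl !subrr inner0l. Qed.

Lemma innerBl x x' y : inner (x - x') y = inner x y - inner x' y.
Proof. by rewrite innerDl innerNl. Qed.

Lemma inner_suml I (r : seq I) (F : I -> l2) y :
  inner (\sum_(i <- r) F i) y = \sum_(i <- r) inner (F i) y.
Proof. exact: (big_morph (inner^~ y) (fun a b => innerDl a b y) (inner0l y)). Qed.

Definition bounded_linear : pred (l2 -> l2) := fun T =>
  `[< linear T /\ exists M : R, forall x, l2norm (T x) <= M * l2norm x >].

Record bop := BOp { bop_fun :> l2 -> l2; bopP : bounded_linear bop_fun }.

HB.instance Definition _ := [isSub for bop_fun].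
HB.instance Definition _ := [Choice of bop by <:].

Lemma bop_linear (T : bop) : linear T.
Proof. by case: T => f /= /asboolP[]. Qed.

Lemma bop_bounded (T : bop) :
  exists2 M : R, 0 <= M & forall x, l2norm (T x) <= M * l2norm x.
Proof.
case: T => f /= /asboolP[_ [M fM]]; exists `|M| => // x; apply: le_trans (fM x) _.
by rewrite ler_wpM2r ?l2norm_ge0 ?ler_norm.
Qed.

HB.instance Definition _ (T : bop) :=
  GRing.isLinear.Build C l2 l2 *:%R T (bop_linear T).

Let bopZ_subproof (c : C) (T : bop) : bounded_linear (fun x => c *: T x).
Proof.
apply/asboolP; split=> [a x y|].
  by rewrite linearP scalerDr !scalerA mulrC.
have [M M0 TM] := bop_bounded T; exists (normc c * M) => x.
rewrite l2normZ -mulrA ler_wpM2l//; by case: (c) => a b; exact: sqrtr_ge0.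
Qed.

Fact bop_submod : submod_closed bounded_linear.
Proof.
split=> [|c f g fP gP].
  apply/asboolP; split=> [a x y|]; first by rewrite scaler0 addr0.
  exists 0 => x; rewrite mul0r -[(0 : l2 -> l2) x](scale0r 0) l2normZ.
  by rewrite Normc.normc0 mul0r.
pose cf := BOp (bopZ_subproof c (BOp fP)); pose T := BOp gP.
apply/asboolP; split=> [a x y|].
  rewrite -[LHS]/(cf (a *: x + y) + T (a *: x + y)).
  rewrite -[RHS]/(a *: (cf x + T x) + (cf y + T y)).
  by rewrite (bop_linear cf) (bop_linear T) addrACA -scalerDr.
have [M M0 fM] := bop_bounded cf; have [N N0 gN] := bop_bounded T.
exists (2 * (M + N)) => x; apply: le_trans (l2norm_crudeD (cf x) (T x)) _.
by rewrite -mulrA ler_wpM2l// mulrDl lerD.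
Qed.

HB.instance Definition _ := GRing.SubChoice_isSubLmodule.Build C (l2 -> l2)
  bounded_linear bop (GRing.submod_closed_semi bop_submod).

Fact bop1_subproof : bounded_linear id.
Proof. by apply/asboolP; split=> //; exists 1 => x; rewrite mul1r. Qed.

Fact bopM_subproof (T U : bop) : bounded_linear (T \o U).
Proof.
apply/asboolP; split=> [a x y|]; first by rewrite /= !linearP.
have [M M0 TM] := bop_bounded T; have [N N0 UN] := bop_bounded U.
exists (M * N) => x; apply: le_trans (TM _) _.
by rewrite -mulrA ler_wpM2l.
Qed.

Definition bop1 := BOp bop1_subproof.
Definition bopM T U := BOp (bopM_subproof T U).

Lemma bop_ext (T U : bop) : (forall x, T x = U x) -> T = U.
Proof. by move=> TU; apply/val_inj/funext. Qed.

Let bopMA : associative bopM. Proof. by move=> ? ? ?; apply: bop_ext. Qed.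
Let bop1M : left_id bop1 bopM. Proof. by move=> ?; apply: bop_ext. Qed.
Let bopM1 : right_id bop1 bopM. Proof. by move=> ?; apply: bop_ext. Qed.
Let bopMDl : left_distributive bopM +%R.
Proof. by move=> ? ? ?; apply: bop_ext. Qed.
Let bopMDr : right_distributive bopM +%R.
Proof. by move=> T U V; apply: bop_ext => x; exact: (linearD T). Qed.

HB.instance Definition _ := GRing.Zmodule_isPzRing.Build bop
  bopMA bop1M bopM1 bopMDl bopMDr.

Lemma bopE : (forall x, (0 : bop) x = 0) * (forall x, (1 : bop) x = x) *
  (forall (T U : bop) x, (T + U) x = T x + U x) *
  (forall (T : bop) x, (- T) x = - T x) *
  (forall (T U : bop) x, (T * U) x = T (U x)) *
  (forall c (T : bop) x, (c *: T) x = c *: T x).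
Proof. by []. Qed.

Lemma bop_sumE I (r : seq I) (F : I -> bop) x :
  (\sum_(i <- r) F i) x = \sum_(i <- r) F i x.
Proof. by elim/big_rec2: _ => // i y T _ <-. Qed.

(* Left translation: (trans g x) h = x (g^-1 h), that is, delta_h is sent to
   delta_(g h). *)
Let trans_subproof1 (g : G) (x : l2) : l2_pred (fun h => x (g^-1 * h)%g).
Proof.
apply/asboolP; apply: le_lt_trans (l2_lt_pinfty x); rewrite le_eqVlt; apply/orP; left.
apply/eqP; rewrite /sqnorm; symmetry.
apply: (reindex_esum [set: G] [set: G] (fun h => (g^-1 * h)%g)).
split=> //= [h k _ _|h _]; first exact: mulgI.
by exists (g * h)%g => //; rewrite mulKg.
Qed.

Definition trans_fun g x : l2 := L2 (trans_subproof1 g x).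

Let sqnorm_trans g x : sqnorm (trans_fun g x) = sqnorm x.
Proof.
rewrite /sqnorm; symmetry.
apply: (reindex_esum [set: G] [set: G] (fun h => (g^-1 * h)%g)).
split=> //= [h k _ _|h _]; first exact: mulgI.
by exists (g * h)%g => //; rewrite mulKg.
Qed.

Let trans_subproof2 g : bounded_linear (trans_fun g).
Proof.
apply/asboolP; split; first by move=> a x y; apply/val_inj.
by exists 1 => x; rewrite mul1r /l2norm sqnorm_trans.
Qed.

Definition trans g : bop := BOp (trans_subproof2 g).

Lemma trans1 : trans 1%g = 1.
Proof.
apply: bop_ext => x; apply/val_inj/funext => h /=.
by rewrite invg1 mul1g.
Qed.

Lemma transM : {morph trans : g h / (g * h)%g >-> g * h}.
Proof.
move=> g h; apply: bop_ext => x; apply/val_inj/funext => k /=.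
by rewrite invgM mulgA.
Qed.

End L2.

Section GroupVonNeumann.
Variables (R : realType) (G : groupType).
Local Notation C := (R[i]).
Local Notation normc := (@Normc.normc R).
Local Notation l2 := (l2 R G).
Local Notation bop := (bop R G).

(* The left regular representation of C[G] on l^2 G. *)
Definition lreg (a : grpring C G) : bop :=
  \sum_(g <- msupp a) mcoeff g a *: trans R g.

Let scal (c : C) : bop := c *: (1 : bop).

Let scalB : zmod_morphism scal.
Proof. by move=> a b; rewrite /scal scalerBl. Qed.

Let scalM : monoid_morphism scal.
Proof.
split; first by rewrite /scal scale1r.
by move=> a b; apply: bop_ext => x; rewrite !bopE scalerA.
Qed.

HB.instance Definition _ := GRing.isZmodMorphism.Build _ _ scal scalB.
HB.instance Definition _ := GRing.isMonoidMorphism.Build _ _ scal scalM.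

Let lregE : lreg = gr_lift scal (@trans R G).
Proof.
apply/funext => a; apply: eq_bigr => g _.
by apply: bop_ext => x; rewrite !bopE.
Qed.

Lemma lreg_is_zmod_morphism : zmod_morphism lreg.
Proof. by rewrite lregE; exact: gr_liftB. Qed.

Lemma lreg_is_monoid_morphism : monoid_morphism lreg.
Proof.
rewrite lregE; apply: gr_liftM; first exact: trans1.
  exact: transM.
by move=> c g; apply: bop_ext => x; rewrite !bopE linearZ.
Qed.

HB.instance Definition _ := GRing.isZmodMorphism.Build _ _ lreg lreg_is_zmod_morphism.
HB.instance Definition _ := GRing.isMonoidMorphism.Build _ _ lreg lreg_is_monoid_morphism.

Lemma lreg_unit g : lreg (gr_unit C g) = trans R g.
Proof. by rewrite lregE gr_liftU; apply: bop_ext => x; rewrite !bopE scale1r. Qed.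

Lemma inner_trans (g : G) (x y : l2) : inner (trans R g x) y = inner x (trans R (g^-1)%g y).
Proof.
have rsum_trans (a : G -> R) : rsum (fun h => a (g^-1 * h)%g) = rsum a.
  have bij : set_bij [set: G] [set: G] (fun h => (g^-1 * h)%g).
    split=> //= [h k _ _|h _]; first exact: mulgI.
    by exists (g * h)%g => //; rewrite mulKg.
  rewrite /rsum [in RHS](reindex_esum _ _ _ _ bij).
  rewrite [X in _ = fine (_ - X)](reindex_esum _ _ _ _ bij).
  by congr (fine (_ - _)); apply: eq_esum => h _; rewrite ?funeposE ?funenegE.
rewrite /inner /csum -[in RHS]rsum_trans -[X in _ = Complex _ X]rsum_trans /=.
by congr Complex; congr rsum; apply/funext => h; rewrite /= invgK mulVKg.
Qed.

(* The closure of the image of C[G] in B(l^2 G) for the weak operator topology,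
   whose basic neighbourhoods of T are the sets of all U such that
   |<(T - U) x, y>| < e for finitely many pairs (x, y). *)
Definition weak_closure : pred bop := fun T =>
  `[< forall (s : seq (l2 * l2)) (e : R), 0 < e ->
      exists a : grpring C G,
        forall p, p \in s -> normc (inner ((T - lreg a) p.1) p.2) < e >].

Let normc_leD (z w : C) : normc (z + w) <= normc z + normc w.
Proof. exact: le_normcD. Qed.

Fact weak_closure_subring : subring_closed weak_closure.
Proof.
split.
- apply/asboolP => s e e0; exists 1 => p _.
  by rewrite rmorph1 subrr bopE inner0l Normc.normc0.
- move=> T U /asboolP wT /asboolP wU; apply/asboolP => s e e0.
  have e20 : 0 < e / 2 by rewrite divr_gt0.
  have [a aP] := wT s _ e20; have [b bP] := wU s _ e20.
  exists (a - b) => p ps.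
  have -> : T - U - lreg (a - b) = (T - lreg a) - (U - lreg b).
    rewrite raddfB /= !opprB -!addrA; congr (_ + _).
    by rewrite addrC [RHS]addrC addrAC.
  rewrite bopE innerDl; apply: le_lt_trans (normc_leD _ _) _.
  rewrite (splitr e); apply: ltrD; first exact: aP.
  rewrite bopE innerNl.
  by rewrite normcN; exact: bP.
- move=> T U /asboolP wT /asboolP wU; apply/asboolP => s e e0.
  have e20 : 0 < e / 2 by rewrite divr_gt0.
  have [a aP] := wT [seq (U p.1, p.2) | p <- s] _ e20.
  pose n := (size (msupp a)).+1.
  have en0 : 0 < e / 2 / n%:R by rewrite divr_gt0// ltr0n.
  have [b bP] := wU [seq (mcoeff g a *: p.1, trans R (g^-1)%g p.2)
                       | g <- msupp a, p <- s] _ en0.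
  exists (a * b) => p ps.
  have -> : T * U - lreg (a * b) = (T - lreg a) * U + lreg a * (U - lreg b).
    by rewrite rmorphM /= mulrBl mulrBr addrA subrK.
  rewrite bopE innerDl; apply: le_lt_trans (normc_leD _ _) _.
  rewrite (splitr e); apply: ltrD.
    by have := aP (U p.1, p.2); apply; apply: map_f.
  rewrite bopE /lreg bop_sumE inner_suml.
  have le_sum (r : seq G) (F : G -> C) : {subset r <= msupp a} ->
      (forall g, g \in msupp a -> normc (F g) <= e / 2 / n%:R) ->
      normc (\sum_(g <- r) F g) <= e / 2 / n%:R *+ size r.
    move=> + Fle; elim: r => [|g r IH] rs; first by rewrite big_nil Normc.normc0.
    rewrite big_cons /= mulrS; apply: le_trans (normc_leD _ _) _.
    apply: lerD; first by apply: Fle; apply: rs; rewrite mem_head.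
    by apply: IH => h hr; apply: rs; rewrite in_cons hr orbT.
  apply: (@le_lt_trans _ _ (e / 2 / n%:R *+ size (msupp a))).
    apply: le_sum => // g gs; rewrite bopE -linearZ inner_trans -linearZ ltW//.
    have := bP (mcoeff g a *: p.1, trans R (g^-1)%g p.2).
    by apply; apply: allpairs_f.
  rewrite -mulr_natr -mulrA gtr_pMr// mulrC ltr_pdivrMr ?ltr0n//.
  by rewrite mul1r ltr_nat.
Qed.

(* The group von Neumann algebra of G. *)
Record vN := VN { vN_val :> bop; vNP : weak_closure vN_val }.

HB.instance Definition _ := [isSub for vN_val].
HB.instance Definition _ := [Choice of vN by <:].
HB.instance Definition _ :=
  GRing.SubChoice_isSubPzRing.Build bop weak_closure vN weak_closure_subring.

Fact lreg_weak_closure a : weak_closure (lreg a).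
Proof.
apply/asboolP => s e e0; exists a => p _.
by rewrite subrr bopE inner0l Normc.normc0.
Qed.

Fact trans_weak_closure g : weak_closure (trans R g).
Proof. by rewrite -lreg_unit; exact: lreg_weak_closure. Qed.

Definition vN_unit g : vN := VN (trans_weak_closure g).

(* The ring morphism Z[G] -> N(G) sending g to left translation by g. *)
Definition vN_of : grpring int G -> vN := gr_lift intr vN_unit.

Let vN_ofB : zmod_morphism vN_of.
Proof. exact: gr_liftB. Qed.

Let vN_ofM : monoid_morphism vN_of.
Proof.
apply: gr_liftM.
- by apply/val_inj; exact: trans1.
- by move=> g h; apply/val_inj; exact: transM.
- by move=> x g; apply: commr_sym; apply: commr_int.
Qed.

HB.instance Definition _ := GRing.isZmodMorphism.Build _ _ vN_of vN_ofB.
HB.instance Definition _ := GRing.isMonoidMorphism.Build _ _ vN_of vN_ofM.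

End GroupVonNeumann.

Section ExtensionOfScalars.
Local Open Scope quotient_scope.
Variables (A B : pzRingType) (phi : {rmorphism A -> B}).

Section Object.
Variable M : lmodType A.

Definition freeBM := malg (B * M)%type int.

HB.instance Definition _ := GRing.Zmodule.on freeBM.

(* The generator b (x) m of the free abelian group on B x M. *)
Definition free_gen (b : B) (m : M) : freeBM := mkmalgU (b, m) 1.

Inductive balanced_rel : freeBM -> Prop :=
| Balanced_addl b c m :
    balanced_rel (free_gen (b + c) m - free_gen b m - free_gen c m)
| Balanced_addr b m n :
    balanced_rel (free_gen b (m + n) - free_gen b m - free_gen b n)
| Balanced_mid b a m :
    balanced_rel (free_gen (b * phi a) m - free_gen b (a *: m)).

Definition balanced_sub : pred freeBM := fun x =>
  `[< forall S : zmodClosed freeBM,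
        (forall y, balanced_rel y -> y \in S) -> x \in S >].

Fact balanced_sub_zmod : zmod_closed balanced_sub.
Proof.
split; first by apply/asboolP => S _; exact: rpred0.
move=> x y /asboolP xP /asboolP yP; apply/asboolP => S SP.
by apply: rpredB; [exact: xP|exact: yP].
Qed.

HB.instance Definition _ := GRing.isZmodClosed.Build freeBM balanced_sub
  balanced_sub_zmod.

(* B (x)_A M, where A acts on the right of B through phi. *)
Definition tens := @Quotient.quot freeBM (GRing.ZmodClosed.clone freeBM balanced_sub _).

HB.instance Definition _ := GRing.Zmodule.on tens.

Definition tens_pi (x : freeBM) : tens := (\pi x)%qT.

Definition pure (b : B) (m : M) : tens := tens_pi (free_gen b m).

Fact tens_pi_additive : zmod_morphism tens_pi.
Proof. by move=> x y; rewrite /tens_pi !piE. Qed.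

HB.instance Definition _ := GRing.isZmodMorphism.Build freeBM tens tens_pi
  tens_pi_additive.

Lemma tens_pi_rel x : balanced_rel x -> tens_pi x = 0.
Proof.
move=> xP; rewrite -[RHS]/(0 : tens) -(raddf0 tens_pi); apply/eqP.
by rewrite /tens_pi piE Quotient.equivE subr0; apply/asboolP => S; apply.
Qed.

Lemma pureDl b c m : pure (b + c) m = pure b m + pure c m.
Proof.
apply/eqP; rewrite -subr_eq0 opprD addrA -!raddfB; apply/eqP.
exact: tens_pi_rel (Balanced_addl _ _ _).
Qed.

Lemma pureDr b m n : pure b (m + n) = pure b m + pure b n.
Proof.
apply/eqP; rewrite -subr_eq0 opprD addrA -!raddfB; apply/eqP.
exact: tens_pi_rel (Balanced_addr _ _ _).
Qed.

Lemma pure_mid b a m : pure (b * phi a) m = pure b (a *: m).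
Proof.
apply/eqP; rewrite -subr_eq0 -!raddfB; apply/eqP.
exact: tens_pi_rel (Balanced_mid _ _ _).
Qed.

Lemma tens_ind (P : tens -> Prop) : P 0 ->
  (forall x y, P x -> P y -> P (x + y)) -> (forall x, P x -> P (- x)) ->
  (forall b m, P (pure b m)) -> forall t, P t.
Proof.
move=> P0 PD PN Pp t; rewrite -[t](reprK (qT := tens)) -[\pi_tens _]/(tens_pi _).
rewrite [repr t]monalgE raddf_sum; elim/big_ind: _ => // -[b m] _.
set z := mcoeff _ _; have -> : mkmalgU (b, m) z = free_gen b m *~ z :> freeBM.
  apply/malgP => k; rewrite raddfMz /= !mcoeffU.
  by case: eqP => _; rewrite ?mulr0n ?mulr1n ?mul0rz ?intz.
rewrite raddfMz /= -/(pure b m).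
have Pn n : P (pure b m *+ n).
  by elim: n => [|n IH]; rewrite ?mulr0n// mulrS; apply: PD.
by case: z => n; [exact: Pn|rewrite NegzE mulrNz; apply/PN/Pn].
Qed.

(* The map induced by f : B -> M -> V; it is meaningful when f is balanced. *)
Section Lift.
Variables (V : zmodType) (f : B -> M -> V).

Definition free_lift (x : freeBM) : V :=
  \sum_(p <- msupp x) f p.1 p.2 *~ mcoeff p x.

Definition tens_lift (t : tens) : V := free_lift (repr t).

Let free_liftw (d : {fset B * M}) x : (msupp x `<=` d)%fset ->
  free_lift x = \sum_(p <- d) f p.1 p.2 *~ mcoeff p x.
Proof.
move=> le; rewrite /free_lift (big_fset_incl _ le) //= => p pd /mcoeff_outdom ->.
by rewrite mulr0z.
Qed.

Let free_liftB : zmod_morphism free_lift.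
Proof.
move=> x y; rewrite (free_liftw (msuppB_le x y)).
rewrite (free_liftw (fsubsetUl _ (msupp y))) (free_liftw (fsubsetUr (msupp x) _)).
by rewrite -sumrB; apply: eq_bigr => p _; rewrite mcoeffB mulrzBr.
Qed.

HB.instance Definition _ := GRing.isZmodMorphism.Build freeBM V free_lift free_liftB.

Let free_lift_gen b m : free_lift (free_gen b m) = f b m.
Proof. by rewrite (free_liftw msuppU_le) big_seq_fset1 mcoeffUU. Qed.

Hypotheses (fDl : forall b c m, f (b + c) m = f b m + f c m)
  (fDr : forall b m n, f b (m + n) = f b m + f b n)
  (fmid : forall b a m, f (b * phi a) m = f b (a *: m)).

Let tens_lift_pi x : tens_lift (tens_pi x) = free_lift x.
Proof.
rewrite /tens_lift /tens_pi.
have : repr (\pi_tens x) == x %[mod tens] by rewrite reprK.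
rewrite -Quotient.idealrBE => /asboolP; set y := repr _ => yx.
pose S : pred freeBM := fun z => free_lift z == 0.
have SP : zmod_closed S.
  split; first by rewrite unfold_in raddf0.
  by move=> u v; rewrite !unfold_in raddfB /= => /eqP-> /eqP->; rewrite subr0.
pose SC := GRing.isZmodClosed.Build freeBM S SP.
pose SZ : zmodClosed freeBM := HB.pack S SC.
have : y - x \in SZ.
  apply: yx => z [b c m|b m n|b a m]; rewrite unfold_in /S !raddfB /= !free_lift_gen.
  - by rewrite fDl addrAC addrK subrr.
  - by rewrite fDr addrAC addrK subrr.
  - by rewrite fmid subrr.
by rewrite unfold_in /S raddfB subr_eq0 => /eqP.
Qed.

Lemma tens_lift_pure b m : tens_lift (pure b m) = f b m.
Proof. by rewrite tens_lift_pi free_lift_gen. Qed.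

Lemma tens_liftB : zmod_morphism tens_lift.
Proof.
move=> s t; rewrite -[s](reprK (qT := tens)) -[t](reprK (qT := tens)).
by rewrite -!/(tens_pi _) -raddfB !tens_lift_pi raddfB.
Qed.

End Lift.

Lemma tens_ext (V : zmodType) (f g : tens -> V) :
  zmod_morphism f -> zmod_morphism g ->
  (forall b m, f (pure b m) = g (pure b m)) -> f =1 g.
Proof.
move=> fB gB fg.
have f0 : f 0 = 0 by rewrite -(subrr (0 : tens)) fB subrr.
have g0 : g 0 = 0 by rewrite -(subrr (0 : tens)) gB subrr.
have fN x : f (- x) = - f x by rewrite -[- x]add0r fB f0 sub0r.
have gN x : g (- x) = - g x by rewrite -[- x]add0r gB g0 sub0r.
elim/tens_ind; first by rewrite f0 g0.
- by move=> x y fx fy; rewrite -[y]opprK fB gB fx !fN !gN fy.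
- by move=> x fx; rewrite fN gN fx.
- exact: fg.
Qed.

Definition tens_scale (c : B) : tens -> tens := tens_lift (fun b m => pure (c * b) m).

Let scaleB c : zmod_morphism (tens_scale c).
Proof.
apply: tens_liftB => *; first by rewrite mulrDr pureDl.
  by rewrite pureDr.
by rewrite mulrA pure_mid.
Qed.

Lemma tens_scale_pure c b m : tens_scale c (pure b m) = pure (c * b) m.
Proof.
apply: (tens_lift_pure (f := fun b m => pure (c * b) m)) => *.
- by rewrite mulrDr pureDl.
- by rewrite pureDr.
- by rewrite mulrA pure_mid.
Qed.

Let scaleA b c t : tens_scale b (tens_scale c t) = tens_scale (b * c) t.
Proof.
move: t; apply: tens_ext => [x y||d m]; rewrite ?scaleB//.
by rewrite !tens_scale_pure mulrA.
Qed.

Let scale1 : left_id 1 tens_scale.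
Proof. by apply: tens_ext => [||b m]//; rewrite tens_scale_pure mul1r. Qed.

Let scaleDr : right_distributive tens_scale +%R.
Proof.
move=> c x y; have sN z : tens_scale c (- z) = - tens_scale c z.
  by rewrite -sub0r scaleB -(subrr (0 : tens)) scaleB subrr sub0r.
by rewrite -[in LHS](opprK y) scaleB sN opprK.
Qed.

Let scaleDl t : {morph tens_scale^~ t : a b / a + b}.
Proof.
move=> a b; move: t.
apply: (@tens_ext _ (tens_scale (a + b)) (fun t => tens_scale a t + tens_scale b t)).
- exact: scaleB.
- by move=> x y; rewrite !scaleB opprD addrACA.
- by move=> c m; rewrite !tens_scale_pure mulrDl pureDl.
Qed.

HB.instance Definition _ := GRing.Zmodule_isLmodule.Build B tens
  scaleA scale1 scaleDr scaleDl.

Lemma tens_scaleE c b m : c *: pure b m = pure (c * b) m.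
Proof. exact: tens_scale_pure. Qed.

End Object.

Section Map.
Variables (M N : lmodType A) (f : {linear M -> N}).

Definition tens_map : tens M -> tens N := tens_lift (fun b m => pure b (f m)).

Let bal : [/\ forall b c m, pure (b + c) (f m) = pure b (f m) + pure c (f m),
  forall b m n, pure b (f (m + n)) = pure b (f m) + pure b (f n) &
  forall b a m, pure (b * phi a) (f m) = pure b (f (a *: m))].
Proof.
split=> *; first exact: pureDl.
  by rewrite linearD pureDr.
by rewrite pure_mid linearZ.
Qed.

Lemma tens_map_pure b m : tens_map (pure b m) = pure b (f m).
Proof. by case: bal => *; rewrite /tens_map tens_lift_pure. Qed.

Let tens_mapB : zmod_morphism tens_map.
Proof. by case: bal => *; exact: tens_liftB. Qed.

Let tens_mapZ : scalable tens_map.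
Proof.
move=> c; apply: (@tens_ext _ _ (fun t => tens_map (c *: t)) (fun t => c *: tens_map t)).
- by move=> x y; rewrite scalerBr tens_mapB.
- by move=> x y; rewrite tens_mapB scalerBr.
- by move=> b m; rewrite tens_scaleE !tens_map_pure tens_scaleE.
Qed.

HB.instance Definition _ := GRing.isZmodMorphism.Build _ _ tens_map tens_mapB.
HB.instance Definition _ := GRing.isScalable.Build B _ _ *:%R tens_map tens_mapZ.

End Map.
End ExtensionOfScalars.

Arguments pure {A B} phi {M} b m.
Arguments tens_map {A B} phi {M N} f.

Definition restr (A B : pzRingType) (phi : {rmorphism A -> B})
  (M : lmodType B) : Type := M.

Section RestrictionOfScalars.
Variables (A B : pzRingType) (phi : {rmorphism A -> B}).

Section Object.
Variable M : lmodType B.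

HB.instance Definition _ := GRing.Zmodule.on (restr phi M).

Definition restr_scale (a : A) (m : restr phi M) : restr phi M := (phi a : B) *: (m : M).

Let scaleA a b m : restr_scale a (restr_scale b m) = restr_scale (a * b) m.
Proof. by rewrite /restr_scale rmorphM scalerA. Qed.
Let scale1 : left_id 1 restr_scale.
Proof. by move=> m; rewrite /restr_scale rmorph1 scale1r. Qed.
Let scaleDr : right_distributive restr_scale +%R.
Proof. by move=> a m n; exact: scalerDr. Qed.
Let scaleDl m : {morph restr_scale^~ m : a b / a + b}.
Proof. by move=> a b; rewrite /restr_scale rmorphD scalerDl. Qed.

HB.instance Definition _ := GRing.Zmodule_isLmodule.Build A (restr phi M)
  scaleA scale1 scaleDr scaleDl.

End Object.

Section Map.
Variables (M N : lmodType B) (f : {linear M -> N}).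

Definition restr_map : restr phi M -> restr phi N := f.

Let restr_mapB : zmod_morphism restr_map.
Proof. exact: (raddfB f). Qed.
Let restr_mapZ : scalable restr_map.
Proof. by move=> a m; exact: (linearZZ f (phi a) m). Qed.

HB.instance Definition _ := GRing.isZmodMorphism.Build _ _ restr_map restr_mapB.
HB.instance Definition _ := GRing.isScalable.Build A _ _ *:%R restr_map restr_mapZ.

End Map.
End RestrictionOfScalars.

Arguments restr_map {A B} phi {M N} f.

Record chain_complex (A : pzRingType) := ChainComplex {
  chain :> int -> lmodType A;
  bd : forall j, {linear chain j -> chain (j - 1)};
  bd_bd : forall j x, bd (j - 1) (bd j x) = 0
}.
Arguments bd {A} _ _.

Record chain_map (A : pzRingType) (X Y : chain_complex A) := ChainMap {
  hom :> forall j, {linear X j -> Y j};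
  hom_bd : forall j x, hom (j - 1) (bd X j x) = bd Y j (hom j x)
}.

Definition chain_iso (A : pzRingType) (X Y : chain_complex A) : Prop :=
  exists (f : chain_map X Y) (g : chain_map Y X),
    forall j, cancel (f j) (g j) /\ cancel (g j) (f j).

Definition concentrated_ge (A : pzRingType) (n : int) (X : chain_complex A) :=
  forall j, j < n -> forall x : X j, x = 0.

Section Homology.
Variables (A : pzRingType) (X : chain_complex A) (j : int).

Definition cycle_pred : pred (X j) := fun x => bd X j x == 0.

Record cycles := Cycle { cycle_val :> X j; cycleP : cycle_pred cycle_val }.

HB.instance Definition _ := [isSub for cycle_val].
HB.instance Definition _ := [Choice of cycles by <:].

Fact cycle_submod : submod_closed cycle_pred.
Proof.
split=> [|a x y]; first by rewrite unfold_in /cycle_pred raddf0.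
by rewrite !unfold_in /cycle_pred linearP => /eqP-> /eqP->; rewrite scaler0 addr0.
Qed.

HB.instance Definition _ := GRing.SubChoice_isSubLmodule.Build A (X j)
  cycle_pred cycles (GRing.submod_closed_semi cycle_submod).

(* The boundary map into degree j: the target X (j + 1 - 1) of bd X (j + 1) is
   only propositionally equal to X j. *)
Definition bd_to (y : X (j + 1)) : X j :=
  ecast i (X i) (addrK 1 j) (bd X (j + 1) y).

Definition boundary_pred : pred cycles :=
  fun z => `[< exists y : X (j + 1), bd_to y = z >].

Fact boundary_zmod : zmod_closed boundary_pred.
Proof.
have castB i (e : i = j) : zmod_morphism (fun x : X i => ecast i (X i) e x).
  by case: j / e => x y.
split.
  apply/asboolP; exists 0.
  by rewrite /bd_to raddf0 -(subrr (0 : X (j + 1 - 1))) castB subrr.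
move=> u v /asboolP[x xu] /asboolP[y yv]; apply/asboolP; exists (x - y).
by rewrite /bd_to raddfB castB -!/(bd_to _) xu yv.
Qed.

HB.instance Definition _ := GRing.isZmodClosed.Build cycles boundary_pred
  boundary_zmod.

(* The quotient of the cycles by the boundaries, as an abelian group. *)
Definition homology :=
  @Quotient.quot cycles (GRing.ZmodClosed.clone cycles boundary_pred _).

HB.instance Definition _ := GRing.Zmodule.on homology.

End Homology.

Section Suspension.
Variables (A : pzRingType) (X : chain_complex A).

Definition susp_bd j (x : X (j - 1)) : X (j - 1 - 1) := - bd X (j - 1) x.

Let susp_bd_linear j : linear (@susp_bd j).
Proof. by move=> a x y; rewrite /susp_bd linearP opprD scalerN. Qed.

HB.instance Definition _ j := GRing.isLinear.Build A _ _ *:%R (@susp_bd j)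
  (@susp_bd_linear j).

Let susp_bd_bd j x : susp_bd (susp_bd x) = 0 :> X (j - 1 - 1 - 1).
Proof. by rewrite /susp_bd raddfN opprK; exact: bd_bd. Qed.

Definition suspension : chain_complex A :=
  @ChainComplex A (fun j => X (j - 1)) (fun j => @susp_bd j) susp_bd_bd.

End Suspension.

Section Cone.
Variables (A : pzRingType) (X Y : chain_complex A) (f : chain_map X Y).

Definition cone_bd j (p : X (j - 1) * Y j) : X (j - 1 - 1) * Y (j - 1) :=
  (- bd X (j - 1) p.1, bd Y j p.2 + f (j - 1) p.1).

Let cone_bd_linear j : linear (@cone_bd j).
Proof.
move=> a x y; congr pair; rewrite /= !linearP//.
by rewrite scalerDr addrACA.
Qed.

HB.instance Definition _ j := GRing.isLinear.Build A _ _ *:%R (@cone_bd j)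
  (@cone_bd_linear j).

Let cone_bd_bd j p : cone_bd (@cone_bd j p) = 0.
Proof.
congr pair; rewrite /= ?linearN ?linearD /=.
  by rewrite opprK; exact: bd_bd.
by rewrite -[RHS](subrr (bd Y (j - 1) (f (j - 1) p.1))) hom_bd bd_bd add0r.
Qed.

Definition cone : chain_complex A :=
  @ChainComplex A (fun j => (X (j - 1) * Y j)%type) (fun j => @cone_bd j)
    cone_bd_bd.

End Cone.

Section ChangeOfRings.
Variables (A B : pzRingType) (phi : {rmorphism A -> B}).

Let tens_bd_bd (X : chain_complex A) j (t : tens phi (X j)) :
  tens_map phi (bd X (j - 1)) (tens_map phi (bd X j) t) = 0.
Proof.
move: t; apply: (@tens_ext _ _ phi _ _ _ (fun=> 0)).
- by move=> x y; rewrite !raddfB.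
- by move=> x y; rewrite subrr.
- move=> b m; rewrite !tens_map_pure bd_bd.
  by apply: (addrI (pure phi b 0)); rewrite -pureDr !addr0.
Qed.

(* The complex B (x)_A X. *)
Definition ext_complex (X : chain_complex A) : chain_complex B :=
  @ChainComplex B (fun j => tens phi (X j)) (fun j => tens_map phi (bd X j))
    (@tens_bd_bd X).

Definition res_complex (X : chain_complex B) : chain_complex A :=
  @ChainComplex A (fun j => restr phi (X j)) (fun j => restr_map phi (bd X j))
    (@bd_bd B X).

End ChangeOfRings.

Local Open Scope classical_set_scope.
Local Open Scope ring_scope.

Definition chain_property :=
  forall G : groupType, int -> chain_complex (grpring int G) -> Prop.

(* A subgroup of G is given by a predicate S on G together with a group structure
   D on a subtype of G carved out by S; S is then closed under the operations. *)
Record equivariantly_bootstrappable (P : chain_property) : Prop := {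
  B_iso : forall (G : groupType) (n : int) (X Y : chain_complex (grpring int G)),
    chain_iso X Y -> P G n X -> P G n Y;
  B_deg : forall (G : groupType) (X : chain_complex (grpring int G)) (m : int),
    concentrated_ge 0 X -> m < 0 -> P G m X;
  B_susp : forall (G : groupType) (n : int) (X : chain_complex (grpring int G)),
    P G n X <-> P G (n + 1) (suspension X);
  B_cone : forall (G : groupType) (n : int) (X Y : chain_complex (grpring int G))
    (f : chain_map X Y), P G (n - 1) X -> P G n Y -> P G n (cone f);
  B_ind : forall (G : groupType) (S : pred G) (D : subGroupType S) (n : int)
    (Z : chain_complex (grpring int D)),
    P D n Z -> P G n (ext_complex (@gr_incl G S D) Z)
}.

(* [set h | S (g^-1 * h)] is the left coset g S. *)
Definition finite_index (G : groupType) (S : pred G) : Prop :=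
  finite_set [set [set h | S (g^-1 * h)%g] | g in [set: G]].

Definition B_res (P : chain_property) : Prop :=
  forall (G : groupType) (S : pred G) (D : subGroupType S) (n : int)
    (X : chain_complex (grpring int G)),
  finite_index S -> P G n X -> P D n (res_complex (@gr_incl G S D) X).

Definition vN_acyclic (R : realType) : chain_property := fun G n X =>
  forall j, j <= n -> forall h : homology (ext_complex (@vN_of R G) X) j, h = 0.

(* Main.v *)
(** All the properties reduce to exactness of N(G) (x) X in a range of degrees,
    and only induction and restriction use more than diagram chasing.

    Induction needs flatness of N(G) over N(D), in the form of the equational
    criterion: if b a = 0 with b a row over N(G) and a a matrix over N(D), let q be
    the projection of l^2(D)^n onto the closure of the range of a.  By the double
    commutant theorem q has entries in N(D), and c = 1 - q satisfies c a = 0 and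
    b = b c.  The same theorem identifies N(G) with the operators commuting with
    right translations, and so embeds N(D) into N(G), an operator T acting on
    l^2(G) coset by coset.

    For restriction to D of finite index, the map N(D) (x) X -> N(G) (x) X has the
    left inverse T (x) x |-> sum_t E(T t^-1) (x) t x, where t runs over
    representatives of the right cosets of D and E : N(G) -> N(D) is the
    conditional expectation. *)
Require Import Defs.
From HB Require Import structures.
From mathcomp Require Import all_boot all_order all_algebra finmap.
From mathcomp Require Import boolp classical_sets functions cardinality fsbigop.
From mathcomp Require Import reals ereal esum numfun.
From mathcomp Require Import complex ring lra.
(* The notations of monalg clash with those of classical_sets. *)
From mathcomp Require Import -(notations) monalg.

Set Implicit Arguments.
Unset Strict Implicit.
Unset Printing Implicit Defensive.
Import Order.TTheory GRing.Theory Num.Theory.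

Local Open Scope ring_scope.

(** * Tensor products *)

(** The obstacle is that N(G) is defined by weak approximation, so an operator built by hand (an
    entry of a projection, an operator acting coset by coset, a compression to l^2(D)) is not
    visibly an element of it. Commuting with right translations, in contrast, is easy to check for
    all three; this is why the double commutant theorem is proved. In the flatness argument the
    range of a is invariant under right translations because the entries of a commute with them,
    whence q has entries in N(D); and b q = 0 because b is bounded and kills the range of a. The
    criterion gives exactness as follows: a cycle is written sum_i b_i (x) x_i with d x_i = sum_m
    a_im m and b a = 0, and b = b c turns it into sum_l b_l (sum_i c_li (x) x_i), where c a = 0
    makes each inner sum a cycle over N(D). The formula for restriction comes from the decomposition
    T = sum_t E(T t^-1) t of N(G) as a finite sum of the N(D) t. A left inverse suffices, since a
    retract of an exact complex is exact. *)

Section TensorMaps.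
Variables (A B : pzRingType) (phi : {rmorphism A -> B}).
Implicit Types M N P : lmodType A.

Lemma pure0r M b : pure phi b (0 : M) = 0.
Proof. by apply: (addrI (pure phi b 0)); rewrite -pureDr !addr0. Qed.

Lemma pure0l M (m : M) : pure phi 0 m = 0.
Proof. by apply: (addrI (pure phi 0 m)); rewrite -pureDl !addr0. Qed.

Lemma pureNl M b (m : M) : pure phi (- b) m = - pure phi b m.
Proof. by apply: (addrI (pure phi b m)); rewrite -pureDl !subrr pure0l. Qed.

Lemma pureNr M b (m : M) : pure phi b (- m) = - pure phi b m.
Proof. by apply: (addrI (pure phi b m)); rewrite -pureDr !subrr pure0r. Qed.

Lemma pure_suml M I (r : seq I) (F : I -> B) (m : M) :
  pure phi (\sum_(i <- r) F i) m = \sum_(i <- r) pure phi (F i) m.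
Proof. exact: (big_morph (fun b => pure phi b m) (fun b c => pureDl phi b c m) (pure0l m)). Qed.

Lemma pure_sumr M I (r : seq I) b (F : I -> M) :
  pure phi b (\sum_(i <- r) F i) = \sum_(i <- r) pure phi b (F i).
Proof. exact: (big_morph (pure phi b) (pureDr phi b) (pure0r M b)). Qed.

Lemma tens_additive_ext M (V : zmodType) (f g : {additive tens phi M -> V}) :
  (forall b m, f (pure phi b m) = g (pure phi b m)) -> f =1 g.
Proof. by move=> fg; apply: tens_ext => //; exact: raddfB. Qed.

Lemma tens_map_comp M N P (g : {linear N -> P}) (f : {linear M -> N})
    (h : {linear M -> P}) (t : tens phi M) :
  (forall m, h m = g (f m)) -> tens_map phi g (tens_map phi f t) = tens_map phi h t.
Proof.
move=> hE; move: t; apply: (@tens_additive_ext _ _ (tens_map phi g \o tens_map phi f)) => b m.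
by rewrite /= !tens_map_pure hE.
Qed.

Lemma tens_map_id M (f : {linear M -> M}) (t : tens phi M) :
  (forall m, f m = m) -> tens_map phi f t = t.
Proof.
move=> fE; move: t; apply: (@tens_additive_ext _ _ (tens_map phi f) idfun) => b m.
by rewrite /= tens_map_pure fE.
Qed.

Lemma tens_map_opp M N (f g : {linear M -> N}) (t : tens phi M) :
  (forall m, g m = - f m) -> tens_map phi g t = - tens_map phi f t.
Proof.
move=> fE; move: t; apply: (@tens_additive_ext _ _ (tens_map phi g) (-%R \o tens_map phi f)) => b m.
by rewrite /= !tens_map_pure fE pureNr.
Qed.

Lemma tens_map_add M N (f g h : {linear M -> N}) (t : tens phi M) :
  (forall m, h m = f m + g m) ->
  tens_map phi h t = tens_map phi f t + tens_map phi g t.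
Proof.
move=> fE; move: t; apply: (@tens_ext _ _ phi _ _ (tens_map phi h)
  (fun t => tens_map phi f t + tens_map phi g t)) => [||b m].
- exact: raddfB.
- by move=> x y; rewrite !raddfB /= opprD addrACA.
- by rewrite /= !tens_map_pure fE pureDr.
Qed.

Lemma tens_sumP M (t : tens phi M) :
  exists s : seq (B * M), t = \sum_(p <- s) pure phi p.1 p.2.
Proof.
elim/tens_ind: t.
- by exists [::]; rewrite big_nil.
- by move=> _ _ [s ->] [s' ->]; exists (s ++ s'); rewrite big_cat.
- move=> _ [s ->]; exists [seq (- p.1, p.2) | p <- s].
  by rewrite big_map -sumrN; apply: eq_bigr => p _; rewrite pureNl.
- by move=> b m; exists [:: (b, m)]; rewrite big_seq1.
Qed.

End TensorMaps.

(** * Vanishing of elements of a tensor product *)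

Section Vanishing.
Variables (A B : pzRingType) (phi : {rmorphism A -> B}) (M : lmodType A).

Let fB := malg M B.

Let rowE (r : B * seq (A * M)) : fB :=
  \sum_(p <- r.2) mkmalgU p.2 (r.1 * phi p.1).

(* The kernel of B (x) A^(M) -> B (x) M, with A^(M) the free module on the set M. *)
Let is_rel (e : fB) := exists2 s : seq (B * seq (A * M)),
  (forall r, r \in s -> \sum_(p <- r.2) p.1 *: p.2 = 0) & e = \sum_(r <- s) rowE r.

Let ev (x : freeBM B M) : fB :=
  \sum_(p <- msupp x) mkmalgU p.2 p.1 *~ mcoeff p x.

Let evw (d : {fset B * M}) (x : freeBM B M) : (msupp x `<=` d)%fset ->
  ev x = \sum_(p <- d) mkmalgU p.2 p.1 *~ mcoeff p x.
Proof.
move=> le; rewrite /ev (big_fset_incl _ le) //= => p pd /mcoeff_outdom ->.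
by rewrite mulr0z.
Qed.

Let evB : zmod_morphism ev.
Proof.
move=> x y; rewrite (evw (msuppB_le x y)).
rewrite (evw (fsubsetUl _ (msupp y))) (evw (fsubsetUr (msupp x) _)).
by rewrite -sumrB; apply: eq_bigr => p _; rewrite mcoeffB mulrzBr.
Qed.

HB.instance Definition _ := GRing.isZmodMorphism.Build (freeBM B M) fB ev evB.

Let ev_gen b m : ev (free_gen b m) = mkmalgU m b.
Proof. by rewrite (evw msuppU_le) big_seq_fset1 mcoeffUU. Qed.

Let rel_pred : pred (freeBM B M) := fun x => `[< is_rel (ev x) >].

Let rel_zmod : zmod_closed rel_pred.
Proof.
split; first by apply/asboolP; rewrite raddf0; exists [::]; rewrite ?big_nil.
move=> x y /asboolP[s sP sE] /asboolP[s' sP' sE']; apply/asboolP.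
exists (s ++ [seq (- r.1, r.2) | r <- s']).
  move=> r; rewrite mem_cat => /orP[/sP//|/mapP[r' /sP' r'P ->]].
  exact: r'P.
rewrite raddfB /= sE sE' big_cat big_map /= -sumrN; congr (_ + _).
apply: eq_bigr => r _; rewrite /rowE -sumrN; apply: eq_bigr => p _.
by rewrite /= mulNr monalgUN.
Qed.

(** The balanced subgroup is the least one containing the balanced relations, and the preimage of
    [is_rel] under [ev] is a subgroup. Additivity in b is killed by [ev]; the other two kinds of
    relation become b times the relations (m + n) - m - n and a m - 1 (a m) of M. *)
Let tens_pi_eq0 (x : freeBM B M) : tens_pi phi x = 0 -> is_rel (ev x).
Proof.
move=> x0; have : balanced_sub phi x.
  have /eqP : tens_pi phi x = tens_pi phi 0 by rewrite x0 raddf0.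
  by rewrite /tens_pi -Quotient.idealrBE subr0.
pose SC := GRing.isZmodClosed.Build (freeBM B M) rel_pred rel_zmod.
pose SZ : zmodClosed (freeBM B M) := HB.pack rel_pred SC.
move=> /asboolP/(_ SZ) xS; suff /xS /asboolP : forall y, balanced_rel phi y -> y \in SZ by [].
move=> y [b c m|b m n|b a m]; apply/asboolP; rewrite !raddfB /= !ev_gen.
- by exists [::] => //; rewrite big_nil monalgUD addrAC addrK subrr.
- exists [:: (b, [:: (1, m + n); (-1, m); (-1, n)])].
    move=> r; rewrite inE => /eqP -> /=; rewrite !big_cons big_nil /= !scaleN1r scale1r addr0.
    by rewrite -opprD subrr.
  by rewrite big_seq1 /rowE /= !big_cons big_nil /= rmorphN rmorph1 mulrN mulr1 !monalgUN addr0 addrA.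
- exists [:: (b, [:: (a, m); (-1, a *: m)])].
    by move=> r; rewrite inE => /eqP -> /=; rewrite !big_cons big_nil /= scaleN1r addr0 subrr.
  by rewrite big_seq1 /rowE /= !big_cons big_nil /= rmorphN rmorph1 mulrN mulr1 !monalgUN addr0.
Qed.

Let sum_pure_eq0 (s : seq (B * M)) : \sum_(p <- s) pure phi p.1 p.2 = 0 ->
  is_rel (\sum_(p <- s) mkmalgU p.2 p.1).
Proof.
rewrite -[X in X = _](raddf_sum (@tens_pi A B phi M)) => /tens_pi_eq0.
by rewrite raddf_sum; under eq_bigr do rewrite /= ev_gen.
Qed.

(* Besides the terms of a given representation of t, the family (b, x) has to
   contain terms with x i = 0, coming from the relations of M. *)
Lemma tens_map_eq0 (N : lmodType A) (f : {linear N -> M}) (t : tens phi N) :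
  tens_map phi f t = 0 ->
  exists (n : nat) (b : 'I_n -> B) (x : 'I_n -> N) (a : 'I_n -> M -> A) (ms : seq M),
  [/\ t = \sum_i pure phi (b i) (x i),
      forall i, f (x i) = \sum_(m <- ms) a i m *: m &
      forall m, m \in ms -> \sum_i b i * phi (a i m) = 0].
Proof.
have [s ->] := tens_sumP t; rewrite raddf_sum.
under eq_bigr do rewrite /= tens_map_pure.
rewrite -(big_map (fun p => (p.1, f p.2)) xpredT (fun p => pure phi p.1 p.2)).
move=> /sum_pure_eq0[s' s'P]; rewrite big_map /= => sE.
(* The terms of t come with the trivial expansion f x = 1 (f x); the relations come with x = 0 and a
   negated coefficient, so that the total in the free module on M is zero. [co] adds up coefficients
   because an element of M may occur several times in one row. *)
pose rows : seq (B * N * seq (A * M)) :=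
  [seq (p, [:: (1, f p.2)]) | p <- s] ++ [seq ((- r.1, 0), r.2) | r <- s'].
pose co (r : B * N * seq (A * M)) m := \sum_(p <- r.2 | p.2 == m) p.1.
pose ms := undup (flatten [seq [seq p.2 | p <- r.2] | r <- rows]).
have rowsP r : r \in rows -> f r.1.2 = \sum_(p <- r.2) p.1 *: p.2.
  rewrite mem_cat => /orP[/mapP[p _ ->]|/mapP[q qs' ->]] /=.
    by rewrite big_seq1 scale1r.
  by rewrite raddf0 s'P.
have in_ms r p : r \in rows -> p \in r.2 -> p.2 \in ms.
  move=> rr pr; rewrite mem_undup; apply/flatten_mapP; exists r => //.
  exact: map_f.
pose T := in_tuple rows.
exists (size rows), (fun i => (tnth T i).1.1), (fun i => (tnth T i).1.2),
  (fun i => co (tnth T i)), ms; split.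
- rewrite -(big_tnth _ _ rows xpredT (fun r => pure phi r.1.1 r.1.2)) big_cat.
  by rewrite !big_map /= [X in _ + X]big1 ?addr0// => r _; rewrite pure0r.
- move=> i; have iT : tnth T i \in rows := mem_tnth _ _.
  rewrite rowsP// /co; under [RHS]eq_bigr do rewrite scaler_suml big_mkcond.
  rewrite exchange_big /= big_seq [RHS]big_seq; apply: eq_bigr => p pi.
  rewrite (bigD1_seq p.2) ?undup_uniq ?(in_ms _ _ iT)//= eqxx.
  by rewrite big1 ?addr0// => m; rewrite eq_sym => /negPf->.
- move=> m mm.
  rewrite -(big_tnth _ _ rows xpredT (fun r => r.1.1 * phi (co r m))).
  have coE r : r.1.1 * phi (co r m) =
      mcoeff m (\sum_(p <- r.2) mkmalgU p.2 (r.1.1 * phi p.1)).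
    rewrite (raddf_sum (mcoeff m)) /co rmorph_sum mulr_sumr big_mkcond.
    apply: eq_bigr => p _; rewrite /= mcoeffU.
    by case: eqP => _; rewrite ?mulr1n ?mulr0n.
  under eq_bigr do rewrite coE.
  rewrite -[X in X = _](raddf_sum (mcoeff m)); transitivity (mcoeff m (0 : fB)); last by rewrite mcoeff0.
  congr (mcoeff m).
  rewrite big_cat !big_map /=; under eq_bigr do rewrite big_seq1 rmorph1 mulr1.
  rewrite sE -big_split /= big1// => r _.
  rewrite /rowE -big_split /= big1// => p _.
  by rewrite mulNr monalgUN subrr.
Qed.

End Vanishing.

(** * Exactness and the formal properties *)

(* Exactness at X (i - 1), indexed so that no cast is needed. *)
Definition exact_below (A : pzRingType) (X : chain_complex A) (i : int) :=
  forall z : X (i - 1), bd X (i - 1) z = 0 -> exists y : X i, bd X i y = z.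

Lemma homology_eq0P (A : pzRingType) (X : chain_complex A) j :
  (forall h : homology X j, h = 0) <-> exact_below X (j + 1).
Proof.
(* Stated for an arbitrary equality of indices, these facts follow by eliminating it, which is
   impossible for [addrK 1 j] itself. *)
have castP k l (e : k = l) (P : forall i, X i -> Prop) (z : X k) :
    P l (ecast i (X i) e z) <-> P k z by case: l / e.
have inj k l (e : k = l) (u v : X k) : ecast i (X i) e u = ecast i (X i) e v -> u = v.
  by case: l / e.
have eK k l (e : k = l) (u : X l) : ecast i (X i) e (ecast i (X i) (esym e) u) = u.
  by case: l / e u.
have pi0 : (\pi_(homology X j) 0)%qT = 0 by rewrite !piE.
split=> [h0 z bz|ex h].
  pose z' : X j := ecast i (X i) (addrK 1 j) z.
  have bz' : cycle_pred z' by apply/eqP; apply/(castP _ _ _ (fun i z => bd X i z = 0)).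
  have /eqP := h0 (\pi_(homology X j) (Cycle bz'))%qT.
  rewrite -pi0 -Quotient.idealrBE subr0 => /asboolP[y yz].
  exists y; move: yz; rewrite /bd_to /z' /=.
  exact: inj.
have /(_ (repr h)) : forall u : cycles X j, boundary_pred u.
  case=> u bu0; apply/asboolP; have /eqP bu := bu0.
  pose v : X (j + 1 - 1) := ecast i (X i) (esym (addrK 1 j)) u.
  have vE : ecast i (X i) (addrK 1 j) v = u by exact: eK.
  have bv : bd X (j + 1 - 1) v = 0.
    by apply/(castP _ _ (addrK 1 j) (fun i z => bd X i z = 0)); rewrite vE.
  by have [y yv] := ex _ bv; exists y; rewrite /bd_to yv vE.
move=> bh; rewrite -[h]reprK; apply/eqP.
by rewrite -pi0 -Quotient.idealrBE subr0.
Qed.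

(** [exact_below _ i] concerns degree i - 1, so the range j <= n becomes i <= n + 1. *)
Lemma vN_acyclicP (R : realType) (G : groupType) n (X : chain_complex (grpring int G)) :
  vN_acyclic R n X <->
  forall i, i <= n + 1 -> exact_below (ext_complex (@vN_of R G) X) i.
Proof.
split=> [vX i|ex j jn].
  have -> : i = (i - 1) + 1 by rewrite subrK.
  by rewrite lerD2r => /vX/homology_eq0P.
by apply/homology_eq0P/ex; rewrite lerD2r.
Qed.

Section TensorPair.
Variables (A B : pzRingType) (phi : {rmorphism A -> B}) (M N : lmodType A).

Definition inl_lin (m : M) : M * N := (m, 0).
Definition inr_lin (n : N) : M * N := (0, n).

Let inl_linear : linear inl_lin.
Proof. by move=> a x y; congr pair; rewrite /= scaler0 addr0. Qed.
Let inr_linear : linear inr_lin.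
Proof. by move=> a x y; congr pair; rewrite /= scaler0 addr0. Qed.

HB.instance Definition _ := GRing.isLinear.Build A M (M * N)%type *:%R inl_lin inl_linear.
HB.instance Definition _ := GRing.isLinear.Build A N (M * N)%type *:%R inr_lin inr_linear.

Let p1 : {linear (M * N)%type -> M} := fst.
Let p2 : {linear (M * N)%type -> N} := snd.

(** The identity of M x N is the sum of the two projections followed by the inclusions, and the
    tensor product is additive on maps. *)
Lemma tens_pairE (t : tens phi (M * N)%type) :
  t = tens_map phi inl_lin (tens_map phi p1 t) + tens_map phi inr_lin (tens_map phi p2 t).
Proof.
rewrite (@tens_map_comp _ _ _ _ _ _ _ _ (inl_lin \o p1))//.
rewrite (@tens_map_comp _ _ _ _ _ _ _ _ (inr_lin \o p2))//.
rewrite -(@tens_map_add _ _ _ _ _ _ _ idfun) ?tens_map_id//.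
by case=> m n; congr pair; rewrite /= ?addr0 ?add0r.
Qed.

Lemma tens_map_fst_inl (u : tens phi M) : tens_map phi p1 (tens_map phi inl_lin u) = u.
Proof. by rewrite (@tens_map_comp _ _ _ _ _ _ _ _ idfun)// tens_map_id. Qed.

Lemma tens_map_snd_inr (u : tens phi N) : tens_map phi p2 (tens_map phi inr_lin u) = u.
Proof. by rewrite (@tens_map_comp _ _ _ _ _ _ _ _ idfun)// tens_map_id. Qed.

Lemma tens_map_fst_inr (u : tens phi N) : tens_map phi p1 (tens_map phi inr_lin u) = 0.
Proof.
rewrite (@tens_map_comp _ _ _ _ _ _ _ _ \0)//.
by have [s ->] := tens_sumP u; rewrite raddf_sum big1// => p _; rewrite /= tens_map_pure pure0r.
Qed.

Lemma tens_map_snd_inl (u : tens phi M) : tens_map phi p2 (tens_map phi inl_lin u) = 0.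
Proof.
rewrite (@tens_map_comp _ _ _ _ _ _ _ _ \0)//.
by have [s ->] := tens_sumP u; rewrite raddf_sum big1// => p _; rewrite /= tens_map_pure pure0r.
Qed.

End TensorPair.

Section ExtComplex.
Variables (A B : pzRingType) (phi : {rmorphism A -> B}).
Implicit Types X Y : chain_complex A.
Local Notation ext X := (ext_complex phi X).

Lemma exact_below_iso X Y i : chain_iso X Y ->
  exact_below (ext X) i -> exact_below (ext Y) i.
Proof.
move=> [f [g fg]] ex z /= bz.
have [|y /= yE] := ex (tens_map phi (g (i - 1)) z).
  have gb m : (bd X (i - 1) \o g (i - 1)) m = g (i - 1 - 1) (bd Y (i - 1) m).
    by rewrite /= -hom_bd.
  rewrite /= (@tens_map_comp _ _ _ _ _ _ _ _ (bd X (i - 1) \o g (i - 1)))//.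
  by rewrite -(tens_map_comp _ gb) bz raddf0.
exists (tens_map phi (f i) y).
have fb m : (bd Y i \o f i) m = f (i - 1) (bd X i m) by rewrite /= -hom_bd.
rewrite (@tens_map_comp _ _ _ _ _ _ _ _ (bd Y i \o f i))//.
rewrite -(tens_map_comp _ fb) yE.
rewrite (@tens_map_comp _ _ _ _ _ _ _ _ (f (i - 1) \o g (i - 1)))// tens_map_id//.
by move=> m /=; case: (fg (i - 1)).
Qed.

Lemma exact_below_concentrated X n i : concentrated_ge n X -> i <= n ->
  exact_below (ext X) i.
Proof.
move=> cX le_in z _; exists 0; rewrite raddf0.
have X0 (m : X (i - 1)) : m = 0 by apply: cX; rewrite ltrBlDr ltzD1.
have [s ->] := tens_sumP z; rewrite big1// => p _.
by rewrite (X0 p.2) pure0r.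
Qed.

Lemma exact_below_susp X i :
  exact_below (ext X) (i - 1) <-> exact_below (ext (suspension X)) i.
Proof.
have bE j (t : ext (suspension X) j) :
    bd (ext (suspension X)) j t = - bd (ext X) (j - 1) t.
  exact: tens_map_opp.
split=> ex z bz.
  have [|y yE] := ex z.
    by apply: oppr_inj; rewrite oppr0 -bz bE.
  by exists (- y : tens phi (X (i - 1))); rewrite bE raddfN opprK.
have [|y yE] := ex z.
  by rewrite bE -[RHS]oppr0; congr (- _).
exists (- y : tens phi (X (i - 1))).
by rewrite raddfN -yE bE.
Qed.

(** For a cycle (x, y), x is a cycle and d y = - f x. With d a = x, the element y + f a is a cycle,
    say d v, and (- a, v) has boundary (x, y). *)
Lemma exact_below_cone X Y (f : chain_map X Y) i :
  exact_below (ext X) (i - 1) -> exact_below (ext Y) i ->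
  exact_below (ext (cone f)) i.
Proof.
move=> exX exY z bz.
pose p1 j : {linear (X (j - 1) * Y j)%type -> X (j - 1)} := fst.
pose p2 j : {linear (X (j - 1) * Y j)%type -> Y j} := snd.
have p1b j (t : ext (cone f) j) : tens_map phi (p1 (j - 1)) (bd (ext (cone f)) j t) =
    - tens_map phi (bd X (j - 1)) (tens_map phi (p1 j) t).
  rewrite (@tens_map_comp _ _ _ _ _ _ _ _ (p1 (j - 1) \o bd (cone f) j))//.
  rewrite (@tens_map_comp _ _ _ _ _ _ _ _ (bd X (j - 1) \o p1 j))//.
  exact: tens_map_opp.
have p2b j (t : ext (cone f) j) : tens_map phi (p2 (j - 1)) (bd (ext (cone f)) j t) =
    tens_map phi (bd Y j) (tens_map phi (p2 j) t) +
    tens_map phi (f (j - 1)) (tens_map phi (p1 j) t).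
  rewrite (@tens_map_comp _ _ _ _ _ _ _ _ (p2 (j - 1) \o bd (cone f) j))//.
  rewrite (@tens_map_comp _ _ _ _ _ _ _ _ (bd Y j \o p2 j))//.
  rewrite (@tens_map_comp _ _ _ _ _ _ _ _ (f (j - 1) \o p1 j))//.
  exact: tens_map_add.
have p12_inj j (t t' : ext (cone f) j) :
    tens_map phi (p1 j) t = tens_map phi (p1 j) t' ->
    tens_map phi (p2 j) t = tens_map phi (p2 j) t' -> t = t'.
  by move=> e1 e2; rewrite [t]tens_pairE [RHS]tens_pairE e1 e2.
have p12_surj j (u : ext X (j - 1)) (v : ext Y j) : exists t : ext (cone f) j,
    tens_map phi (p1 j) t = u /\ tens_map phi (p2 j) t = v.
  exists (tens_map phi (@inl_lin _ _ _) u + tens_map phi (@inr_lin _ _ _) v).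
  rewrite /p1 /p2 !raddfD /= tens_map_fst_inl tens_map_snd_inr tens_map_fst_inr tens_map_snd_inl.
  by rewrite addr0 add0r.
have [|a aE] := exX (tens_map phi (p1 (i - 1)) z).
  by apply: oppr_inj; rewrite oppr0 -p1b bz raddf0.
have [|v vE] := exY (tens_map phi (p2 (i - 1)) z + tens_map phi (f (i - 1)) a).
  rewrite raddfD /=; have fb m : (f (i - 1 - 1) \o bd X (i - 1)) m = bd Y (i - 1) (f (i - 1) m).
    exact: hom_bd.
  rewrite (tens_map_comp _ fb) -(@tens_map_comp _ _ _ _ _ _ (f (i - 1 - 1)) (bd X (i - 1)))//.
  by rewrite aE -p2b bz raddf0.
have [t [t1 t2]] := p12_surj _ (- a : tens phi (X (i - 1))) v.
exists t; apply: p12_inj.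
  by rewrite p1b t1 raddfN opprK.
by rewrite p2b t1 t2 raddfN vE addrK.
Qed.

End ExtComplex.

(** * Orthogonal projections *)

Section Projection.
Variables (R : realType) (V : lmodType R[i]) (rip : V -> V -> R).
Hypotheses (ripC : forall x y, rip x y = rip y x)
  (ripDl : forall x y z, rip (x + y) z = rip x z + rip y z)
  (ripZl : forall (c : R) x y, rip (c%:C%C *: x) y = c * rip x y)
  (rip_ge0 : forall x, 0 <= rip x x).

Local Notation nsq x := (rip x x).

Let rip0l y : rip 0 y = 0.
Proof. by apply: (addrI (rip 0 y)); rewrite -ripDl !addr0. Qed.

Lemma rip_Nl x y : rip (- x) y = - rip x y.
Proof. by apply: (addrI (rip x y)); rewrite -ripDl !subrr rip0l. Qed.

Lemma rip_Nr x y : rip x (- y) = - rip x y.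
Proof. by rewrite ripC rip_Nl ripC. Qed.

Lemma rip_Dr x y z : rip x (y + z) = rip x y + rip x z.
Proof. by rewrite ripC ripDl !(ripC x). Qed.

Lemma rip_Zr (c : R) x y : rip x (c%:C%C *: y) = c * rip x y.
Proof. by rewrite ripC ripZl ripC. Qed.

Let ripE := (ripDl, rip_Dr, rip_Nl, rip_Nr, ripZl, rip_Zr).

(** The form is only assumed semidefinite. If nsq y = 0, the polynomial [quad] is affine in t, and a
    nonzero slope would let it take the value -1; otherwise it is evaluated at its minimum. *)
Lemma rip_CS x y : rip x y ^+ 2 <= nsq x * nsq y.
Proof.
have quad (t : R) : 0 <= nsq x + 2 * t * rip x y + t ^+ 2 * nsq y.
  have := rip_ge0 (x + t%:C%C *: y); rewrite !ripE (ripC y x) => h.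
  rewrite expr2; lra.
have [y0|yN0] := eqVneq (nsq y) 0.
  have [->|rN0] := eqVneq (rip x y) 0; first by rewrite expr0n y0 mulr0.
  have := quad (- (nsq x + 1) / (2 * rip x y)); rewrite y0 mulr0 addr0.
  have -> : nsq x + 2 * (- (nsq x + 1) / (2 * rip x y)) * rip x y = - 1.
    by field.
  by rewrite oppr_ge0 ler10.
have y_gt0 : 0 < nsq y by rewrite lt_def yN0 rip_ge0.
have := quad (- rip x y / nsq y).
have -> : nsq x + 2 * (- rip x y / nsq y) * rip x y + (- rip x y / nsq y) ^+ 2 * nsq y =
   (nsq x * nsq y - rip x y ^+ 2) / nsq y by field.
by rewrite pmulr_lge0 ?invr_gt0// subr_ge0.
Qed.

Lemma nsqD_le x y : nsq (x + y) <= 2 * nsq x + 2 * nsq y.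
Proof.
have := rip_ge0 (x - y); rewrite !ripE (ripC y x) => h.
by lra.
Qed.

Definition rip_closure (L : V -> Prop) x :=
  forall e, 0 < e -> exists2 w, L w & nsq (x - w) < e.

Lemma closure_orth (L : V -> Prop) u v : rip_closure L u ->
  (forall w, L w -> rip v w = 0) -> rip v u = 0.
Proof.
move=> clu vL; apply/eqP; rewrite -sqrf_eq0; apply/eqP/le_anti/andP; split; last exact: sqr_ge0.
apply/ler_addgt0Pr => e e0; rewrite add0r.
have v1 : 0 < nsq v + 1 by have := rip_ge0 v; lra.
(* Chosen so that Cauchy-Schwarz bounds the square of rip v (u - w) by e; the added 1 covers nsq v =
   0. *)
have [w Lw uw] := clu (e / (nsq v + 1)) (divr_gt0 e0 v1).
have -> : rip v u = rip v (u - w) by rewrite rip_Dr rip_Nr (vL w)// subr0.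
apply: le_trans (rip_CS _ _) _.
have -> : e = (nsq v + 1) * (e / (nsq v + 1)) by field; lra.
apply: ler_pM; rewrite ?rip_ge0//; last exact: ltW.
by lra.
Qed.

Definition rip_complete := forall u : nat -> V,
  (forall e, 0 < e -> exists N, forall k l, (N <= k)%N -> (N <= l)%N -> nsq (u k - u l) < e) ->
  exists x, forall e, 0 < e -> exists N, forall k, (N <= k)%N -> nsq (u k - x) < e.

(** A sequence in L minimizing the distance to x converges to u. As L need not be closed, u lies
    only in its closure. *)
Lemma projection_exists (L : V -> Prop) : rip_complete ->
  L 0 -> (forall x y, L x -> L y -> L (x + y)) ->
  (forall (c : R) x, L x -> L (c%:C%C *: x)) ->
  forall x, exists u, rip_closure L u /\ forall w, L w -> rip (x - u) w = 0.
Proof.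
move=> complete L0 LD LZ x.
pose D := [set nsq (x - w) | w in L]%classic.
have infD : has_inf D.
  split; first by exists (nsq (x - 0)), 0.
  by exists 0 => _ [w _ <-].
pose d := inf D.
have d_le w : L w -> d <= nsq (x - w).
  by move=> Lw; apply: ge_inf; [case: infD|exists w].
have near k : exists w, L w /\ nsq (x - w) < d + k.+1%:R^-1.
  have [_ [w Lw <-] h] := @inf_adherent _ D k.+1%:R^-1 (ltac:(by rewrite invr_gt0)) infD.
  by exists w.
have [u uP] := choice near.
have inv_small (e : R) : 0 < e -> exists N, forall k, (N <= k)%N -> k.+1%:R^-1 < e.
  move=> e0; exists (Num.truncn (e^-1)) => k Nk.
  rewrite -[e]invrK ltf_pV2 ?posrE ?invr_gt0 ?ltr0n//.
  have : e^-1 < (Num.truncn e^-1).+1%:R by rewrite Num.Theory.truncnS_gt.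
  by move/lt_le_trans; apply; rewrite ler_nat.
have cauchy k l : nsq (u k - u l) <= 2 * k.+1%:R^-1 + 2 * l.+1%:R^-1.
  have [[Lk dk] [Ll dl]] := (uP k, uP l).
  (* The midpoint lies in L, hence at squared distance at least d from x; the parallelogram law then
     gives the bound. *)
  have /d_le : L (2^-1%:C%C *: (u k + u l)) by apply/LZ/LD.
  rewrite !ripE (ripC (u k) x) (ripC (u l) x) (ripC (u l) (u k)).
  move: dk dl; rewrite !ripE (ripC (u k) x) (ripC (u l) x).
  move: (k.+1%:R^-1) (l.+1%:R^-1) => a b dk dl dm; lra.
have [|y yP] := complete u.
  move=> e e0; have [N NP] := inv_small (e / 4) (ltac:(by rewrite divr_gt0)).
  exists N => k l /NP hk /NP hl; apply: le_lt_trans (cauchy k l) _.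
  by move: (k.+1%:R^-1) (l.+1%:R^-1) hk hl => a b; lra.
exists y; split.
  move=> e /yP[N NP]; exists (u N); first by case: (uP N).
  by rewrite -opprB rip_Nl rip_Nr opprK; exact: NP.
move=> w Lw.
(* Moving u k by t w cannot reduce the squared distance below d, which u k exceeds by less than
   1/(k+1); the best t is rip (x - u k) w / nsq w. *)
have orth k : rip (x - u k) w ^+ 2 <= nsq w * k.+1%:R^-1.
  have [Lk dk] := uP k.
  have quad (t : R) : 2 * t * rip (x - u k) w <= k.+1%:R^-1 + t ^+ 2 * nsq w.
    have /d_le : L (u k + t%:C%C *: w) by apply: LD => //; apply: LZ.
    rewrite opprD addrA.
    move: dk; move: (x - u k) (k.+1%:R^-1) => z a dk.
    by rewrite !ripE (ripC w z) expr2 => h; lra.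
  have [w0|wN0] := eqVneq (nsq w) 0.
    have /(le_trans _) := rip_CS (x - u k) w; rewrite w0 mulr0 mul0r.
    by move=> h; have := rip_CS (x - u k) w; rewrite w0 mulr0.
  have w_gt0 : 0 < nsq w by rewrite lt_def wN0 rip_ge0.
  have := quad (rip (x - u k) w / nsq w).
  set r := rip _ _; have -> : 2 * (r / nsq w) * r = 2 * (r ^+ 2 / nsq w) by field.
  have -> : (r / nsq w) ^+ 2 * nsq w = r ^+ 2 / nsq w by field.
  move=> h; have {}h : r ^+ 2 / nsq w <= k.+1%:R^-1.
    by move: (k.+1%:R^-1) (r ^+ 2 / nsq w) h => a b; lra.
  by rewrite mulrC -ler_pdivrMr.
apply/eqP; rewrite -sqrf_eq0; apply/eqP/le_anti/andP; split; last exact: sqr_ge0.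
apply/ler_addgt0Pr => e e0; rewrite add0r.
(* This makes p^2 and q^2 at most e / 4, and (p + q)^2 <= 2 p^2 + 2 q^2. *)
have c0 : 0 < e / (4 * (nsq w + 1)).
  by rewrite divr_gt0// mulr_gt0//; have := rip_ge0 w; lra.
have [[N NP] [N' N'P]] := (yP _ c0, inv_small _ c0).
pose k := maxn N N'.
have h1 := NP k (leq_maxl _ _); have h2 := N'P k (leq_maxr _ _).
have -> : x - y = (x - u k) + (u k - y) by rewrite addrA subrK.
rewrite ripDl; have := orth k; have := rip_CS (u k - y) w.
set p := rip (x - u k) w; set q := rip (u k - y) w => hq hp.
have {}hq : q ^+ 2 <= e / 4.
  apply: le_trans hq _; have -> : e / 4 = e / (4 * (nsq w + 1)) * (nsq w + 1).
    by field; have := rip_ge0 w; lra.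
  by apply: ler_pM; rewrite ?rip_ge0 ?(ltW h1)//; lra.
have {}hp : p ^+ 2 <= e / 4.
  apply: le_trans hp _; have -> : e / 4 = (nsq w + 1) * (e / (4 * (nsq w + 1))).
    by field; have := rip_ge0 w; lra.
  by apply: ler_pM; rewrite ?rip_ge0 ?invr_ge0 ?(ltW h2)//; lra.
have := sqr_ge0 (p - q); rewrite sqrrB sqrrD; lra.
Qed.

End Projection.

(** * Sums of real families *)

Section RealSums.
Variables (R : realType) (I : choiceType).
Implicit Types (a b : I -> R).

Lemma rsum_ge0E a : (forall i, 0 <= a i) ->
  rsum a = fine (\esum_(i in [set: I]) (a i)%:E).
Proof.
move=> a0; rewrite /rsum [X in (_ - X)%E]esum1 ?sube0.
  congr fine; apply: eq_esum => i _; rewrite funeposE /=.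
  by rewrite max_l// lee_fin.
move=> i _; rewrite funenegE /= max_r// ?lee_fin// oppr_le0//.
Qed.

Lemma rsum0 : rsum (fun _ : I => 0 : R) = 0.
Proof. by rewrite rsum_ge0E// esum1. Qed.

Lemma rsummableN a : rsummable a -> rsummable (fun i => - a i).
Proof. by apply: le_lt_trans; apply: le_esum => i _ /=; rewrite normrN. Qed.

Lemma rsumN a : rsummable a -> rsum (fun i => - a i) = - rsum a.
Proof.
move=> sa; apply: (addrI (rsum a)); rewrite -rsumD//; last exact: rsummableN.
by rewrite subrr -[RHS]rsum0; congr rsum; apply/funext => i; rewrite subrr.
Qed.

Let rsumE a : rsum a = fine (\esum_(i in [set: I]) (Num.max (a i) 0)%:E -
  \esum_(i in [set: I]) (Num.max (- a i) 0)%:E)%E.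
Proof.
rewrite /rsum; congr (fine (_ - _)); apply: eq_esum => i _.
  by rewrite funeposE /= EFin_max.
by rewrite funenegE /= EFin_max.
Qed.

Lemma rsumZ (c : R) a : rsummable a -> rsum (fun i => c * a i) = c * rsum a.
Proof.
have pos d : 0 <= d -> rsummable a -> rsum (fun i => d * a i) = d * rsum a.
  move=> d0 sa; rewrite !rsumE.
  have max0 b i : 0 <= Num.max (b i) 0 :> R by rewrite le_max lexx orbT.
  have maxZ (x : R) : Num.max (d * x) 0 = d * Num.max x 0 by rewrite maxr_pMr// mulr0.
  under eq_esum do rewrite maxZ.
  under [X in (_ - X)%E]eq_esum do rewrite -mulrN maxZ.
  rewrite !esumZ_fin//; last by move=> i; exact: (max0 (fun i => - a i)).
  have fin (b : I -> R) : (forall i, Num.max (b i) 0 <= `|a i|) ->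
      \esum_(i in [set: I]) (Num.max (b i) 0)%:E \is a fin_num.
    move=> ba; rewrite ge0_fin_numE; last by apply: esum_ge0 => i _; rewrite lee_fin.
    by apply: le_lt_trans sa; apply: le_esum => i _; rewrite lee_fin.
  have f1 := fin a (ltac:(by move=> i; rewrite ge_max normr_ge0 ler_norm)).
  have f2 := fin (fun i => - a i) (ltac:(by move=> i; rewrite ge_max normr_ge0 -normrN ler_norm)).
  by rewrite -(fineK f1) -(fineK f2) -!EFinM -!EFinB /= mulrBr.
move=> sa; have [c0|c0] := leP 0 c; first exact: pos.
have := pos (- c) (ltac:(by rewrite oppr_ge0 ltW)) sa.
have -> : (fun i => - c * a i) = (fun i => - (c * a i)) by apply/funext => i; rewrite mulNr.
rewrite rsumN.
  by rewrite mulNr => /oppr_inj.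
rewrite /rsummable /summable; under eq_esum do rewrite /= normrM.
rewrite esumZ_fin//.
have fa : \esum_(i in [set: I]) (`|a i|)%:E \is a fin_num.
  by rewrite ge0_fin_numE//; apply: esum_ge0 => i _; rewrite lee_fin.
by rewrite -(fineK fa) -EFinM ltry.
Qed.

Lemma esum_single (f : I -> \bar R) i : (0 <= f i)%E ->
  (forall j, j != i -> f j = 0%E) -> \esum_(j in [set: I]) f j = f i.
Proof.
move=> f0 fi; rewrite -[RHS]esum_set1// [RHS]esum_mkcond; apply: eq_esum => j _.
by case: ifPn => //; rewrite in_set1 => /fi.
Qed.

Lemma rsum_single a i : (forall j, j != i -> a j = 0) -> rsum a = a i.
Proof.
move=> ai; have S (b : I -> R) : (forall j, j != i -> b j = 0) ->
    \esum_(j in [set: I]) (Num.max (b j) 0)%:E = (Num.max (b i) 0)%:E.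
  move=> bi; apply: (@esum_single (fun j => (Num.max (b j) 0)%:E)).
    by rewrite lee_fin le_max lexx orbT.
  by move=> j /bi ->; rewrite maxxx.
rewrite rsumE S// (S (fun j => - a j)); last by move=> j /ai ->; rewrite oppr0.
rewrite -EFinB /=; case: (leP (a i) 0) => h.
  by rewrite max_l ?oppr_ge0// opprK add0r.
by rewrite max_r ?oppr_le0 ?subr0// ltW.
Qed.

End RealSums.

Section RealCauchy.
Variable R : realType.

Lemma real_cauchy_limit (r : nat -> R) :
  (forall e, 0 < e -> exists N, forall k l, (N <= k)%N -> (N <= l)%N -> r k - r l < e) ->
  exists l, forall e, 0 < e -> exists N, forall k, (N <= k)%N -> `|r k - l| < e.
Proof.
(* The set of eventual lower bounds, whose supremum is the lower limit of r. *)
move=> cr; pose S := [set a | exists N, forall k, (N <= k)%N -> a <= r k]%classic.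
have ubS e N : (forall k l, (N <= k)%N -> (N <= l)%N -> r k - r l < e) ->
    ubound S (r N + e).
  move=> NP a [M Ma]; have := Ma _ (leq_maxl M N).
  have := NP _ _ (leq_maxr M N) (leqnn N); lra.
have inS e N : (forall k l, (N <= k)%N -> (N <= l)%N -> r k - r l < e) -> S (r N - e).
  by move=> NP; exists N => k Nk; have := NP _ _ (leqnn N) Nk; lra.
have supS : has_sup S.
  have [N NP] := cr 1 ltr01; split; first by exists (r N - 1); exact: inS.
  by exists (r N + 1); exact: ubS.
exists (sup S) => e e0; have [N NP] := cr (e / 2) (ltac:(by rewrite divr_gt0)).
have h1 : r N - e / 2 <= sup S by apply: ub_le_sup; [case: supS|exact: inS].
have h2 : sup S <= r N + e / 2 by apply: ge_sup; [case: supS|exact: ubS].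
exists N => k Nk; have := NP _ _ Nk (leqnn N); have := NP _ _ (leqnn N) Nk.
by move=> h3 h4; rewrite ltr_norml; apply/andP; split; lra.
Qed.

End RealCauchy.

(** * The Hilbert space l^2(G) *)

Section L2Theory.
Variables (R : realType) (G : groupType).
Local Notation C := (R[i]).
Local Notation normc := (@Normc.normc R).
Local Notation l2 := (l2 R G).
Implicit Types (x y z : l2) (g h : G).

Definition rip x y : R := complex.Re (inner x y).

Lemma l2E : (forall g, (0 : l2) g = 0) * (forall x y g, (x + y) g = x g + y g) *
  (forall x g, (- x) g = - x g) * (forall c x g, (c *: x) g = c * x g).
Proof. by []. Qed.

Lemma l2_ext x y : (forall g, x g = y g) -> x = y.
Proof. by move=> xy; apply/val_inj/funext. Qed.

Lemma l2_sumE I (r : seq I) (F : I -> l2) g : (\sum_(i <- r) F i) g = \sum_(i <- r) F i g.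
Proof. by elim/big_rec2: _ => // i y T _ <-. Qed.

Let reE x y : (fun g => complex.Re (x g * conjc (y g))) =
  (fun g => complex.Re (x g) * complex.Re (y g) + complex.Im (x g) * complex.Im (y g)).
Proof. by apply/funext => g; case: (x g) (y g) => a b [c d] /=; ring. Qed.

Lemma ripE x y : rip x y =
  rsum (fun g => complex.Re (x g) * complex.Re (y g) + complex.Im (x g) * complex.Im (y g)).
Proof. by rewrite -reE. Qed.

Lemma ripC x y : rip x y = rip y x.
Proof.
rewrite /rip /inner /= !reE; congr rsum.
by apply/funext => g; rewrite mulrC [X in _ + X]mulrC.
Qed.

Lemma ripDl x y z : rip (x + y) z = rip x z + rip y z.
Proof. by rewrite /rip innerDl; case: (inner x z) (inner y z) => ? ? []. Qed.

Lemma ripZl (c : R) x y : rip (c%:C%C *: x) y = c * rip x y.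
Proof.
rewrite !ripE -rsumZ; last by rewrite -reE; case: (csummable_inner x y).
congr rsum; apply/funext => g; rewrite l2E.
by case: (x g) (y g) => a b [d e] /=; ring.
Qed.

Lemma rip_norm x : rip x x = l2norm x ^+ 2.
Proof.
rewrite /rip /inner /= reE rsum_ge0E; last first.
  by move=> g; rewrite addr_ge0// -expr2 sqr_ge0.
apply/eqP; rewrite -eqe sqr_l2norm fineK.
  by apply/eqP/eq_esum => g _; rewrite Defs.sqr_normc !expr2.
rewrite ge0_fin_numE; last by apply: esum_ge0 => g _; rewrite lee_fin addr_ge0// -expr2 sqr_ge0.
apply: le_lt_trans (l2_lt_pinfty x); rewrite le_eqVlt; apply/orP; left; apply/eqP.
by apply: eq_esum => g _; rewrite Defs.sqr_normc !expr2.
Qed.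

Lemma rip_ge0 x : 0 <= rip x x.
Proof. by rewrite rip_norm sqr_ge0. Qed.

Lemma rip_le x y : `|rip x y| <= l2norm x * l2norm y.
Proof.
rewrite -(@ler_pXn2r _ 2)// ?nnegrE ?mulr_ge0 ?l2norm_ge0//.
rewrite real_normK ?num_real// exprMn -!rip_norm.
by apply: rip_CS; [exact: ripC|exact: ripDl|exact: ripZl|exact: rip_ge0].
Qed.

(** Multiplication by -i turns imaginary parts into real parts, so that estimates for [rip] carry
    over to [inner]. *)
Lemma innerE x y : inner x y = Complex (rip x y) (rip (Complex 0 (-1) *: x) y).
Proof.
rewrite ripE -[LHS]/(Complex (rip x y) (rsum (fun g => complex.Im (x g * conjc (y g))))).
congr Complex; congr rsum; apply/funext => g; rewrite ?l2E;
by case: (x g) (y g) => a b [c d] /=; ring.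
Qed.

Lemma normc_Re_Im (z : C) : normc z <= `|complex.Re z| + `|complex.Im z|.
Proof.
rewrite -(@ler_pXn2r _ 2)// ?nnegrE ?addr_ge0//; last by case: z => a b; exact: sqrtr_ge0.
rewrite Defs.sqr_normc sqrrD !real_normK ?num_real// lerD2r lerDl mulrn_wge0// ?mulr_ge0.
Qed.

Lemma normc_inner_le x y : normc (inner x y) <= 2 * (l2norm x * l2norm y).
Proof.
apply: le_trans (normc_Re_Im _) _; rewrite innerE /=.
have := rip_le x y; have := rip_le (Complex 0 (-1) *: x) y; rewrite l2normZ.
have -> : normc (Complex 0 (-1)) = 1 by rewrite /= expr0n add0r sqrrN expr1n sqrtr1.
rewrite mul1r; lra.
Qed.

Lemma normc_coord x g : normc (x g) <= l2norm x.
Proof.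
rewrite -(@ler_pXn2r _ 2)// ?nnegrE ?l2norm_ge0//; last first.
  by case: (x g) => a b; exact: sqrtr_ge0.
rewrite -lee_fin sqr_l2norm.
pose f h : \bar R := if h == g then (normc (x h) ^+ 2)%:E else 0%E.
have <- : \esum_(h in [set: G]) f h = (normc (x g) ^+ 2)%:E.
  rewrite (@esum_single _ _ f g) /f ?eqxx ?lee_fin ?sqr_ge0//.
  by move=> h /negPf ->.
by apply: le_esum => h _; rewrite /f; case: ifP => // _; rewrite lee_fin sqr_ge0.
Qed.

Lemma l2norm_eq0 x : l2norm x = 0 -> x = 0.
Proof.
move=> x0; apply: l2_ext => g; have := normc_coord x g; rewrite x0 => h.
apply: Normc.eq0_normc; apply/le_anti; rewrite h /=; by case: (x g) => a b; exact: sqrtr_ge0.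
Qed.


Lemma delta_subproof g : l2_pred (fun h => (h == g)%:R : C).
Proof.
apply/asboolP; rewrite /sqnorm (@esum_single _ _ _ g) ?ltry//.
  by rewrite lee_fin sqr_ge0.
by move=> h /negPf ->; rewrite Normc.normc0 expr0n.
Qed.

Definition delta g : l2 := L2 (delta_subproof g).

Lemma inner_delta x g : inner x (delta g) = x g.
Proof.
rewrite /inner /csum !(@rsum_single _ _ _ g) /=.
- by rewrite eqxx; case: (x g) => a b /=; congr Complex; ring.
- by move=> h /negPf ->; case: (x h) => a b /=; ring.
- by move=> h /negPf ->; case: (x h) => a b /=; ring.
Qed.

(** X carries more than ||x||^2 - e^2 of the total mass, so less than e^2 remains outside any F
    containing X. Allowing every larger F lets two vectors be truncated compatibly. *)
Lemma l2_approx x (e : R) : 0 < e -> exists X : {fset G}, forall F : {fset G},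
  (X `<=` F)%fset -> l2norm (x - \sum_(g <- F) x g *: delta g) < e.
Proof.
move=> e0; have e20 : 0 < e ^+ 2 by rewrite exprn_gt0.
have : ((l2norm x ^+ 2 - e ^+ 2)%:E < sqnorm x)%E.
  by rewrite -sqr_l2norm lte_fin ltrBlDr ltrDl.
move=> /ereal_sup_gt[_ [X [finX _] <-] ltX].
exists (fset_set X) => F XF.
rewrite -(@ltr_pXn2r _ 2)// ?nnegrE ?l2norm_ge0 ?(ltW e0)//.
pose y := x - \sum_(g <- F) x g *: delta g.
have yE h : y h = if h \in F then 0 else x h.
  rewrite /y !l2E l2_sumE; under eq_bigr do rewrite l2E /=.
  case: ifPn => hF.
    rewrite (bigD1_seq h) ?fset_uniq//= eqxx mulr1 big1 ?addr0 ?subrr//.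
    by move=> g; rewrite eq_sym => /negPf ->; rewrite mulr0.
  rewrite big_seq big1 ?subr0// => g gF.
  by case: eqP => [hg|]; rewrite ?mulr0//; move: hF; rewrite hg gF.
rewrite -/y -lte_fin sqr_l2norm.
have := esumID [set` F] [set: G] (fun h => (normc (x h) ^+ 2)%:E).
rewrite setTI => /(_ (ltac:(by move=> h _; rewrite lee_fin sqr_ge0))).
rewrite -/(sqnorm x) esum_mkcondr.
have -> : \esum_(h in [set: G]) (if h \in (~` [set` F])%classic
    then (normc (x h) ^+ 2)%:E else 0%E) = sqnorm y.
  apply: eq_esum => h _; rewrite yE in_setC.
  have -> : (h \in [set` F]%classic) = (h \in F) by apply/idP/idP; rewrite inE.
  by case: (h \in F) => //=; rewrite expr0n addr0 sqrtr0 expr0n.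
have : (\sum_(h \in X) (normc (x h) ^+ 2)%:E <= \esum_(h in [set` F]) (normc (x h) ^+ 2)%:E)%E.
  apply: ereal_sup_ubound; exists X => //; split=> // h Xh.
  by apply/(fsubsetP XF); rewrite in_fset_set// inE.
move: ltX; rewrite -!sqr_l2norm.
set s := (\sum_(h \in X) _)%E; set t := \esum_(h in _) _.
move=> h1 h2 h3.
have : ((l2norm x ^+ 2 - e ^+ 2)%:E < t)%E by apply: lt_le_trans h1 h2.
case: t h3 {h2} => [t| |] //=.
by rewrite -EFinD lte_fin => -[->]; rewrite !lte_fin; lra.
Qed.

End L2Theory.

Section L2Complete.
Variables (R : realType) (G : groupType).
Local Notation C := (R[i]).
Local Notation normc := (@Normc.normc R).
Local Notation l2 := (l2 R G).

Lemma normc_ge0 (z : C) : 0 <= normc z.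
Proof. by case: z => a b; exact: sqrtr_ge0. Qed.

Lemma ler_Re_normc (z : C) : `|complex.Re z| <= normc z.
Proof.
rewrite -(@ler_pXn2r _ 2)// ?nnegrE ?normc_ge0//.
by rewrite Defs.sqr_normc real_normK ?num_real// lerDl sqr_ge0.
Qed.

Lemma ler_Im_normc (z : C) : `|complex.Im z| <= normc z.
Proof.
rewrite -(@ler_pXn2r _ 2)// ?nnegrE ?normc_ge0//.
by rewrite Defs.sqr_normc real_normK ?num_real// lerDr sqr_ge0.
Qed.

Lemma complex_cauchy_limit (z : nat -> C) :
  (forall e, 0 < e -> exists N, forall k l, (N <= k)%N -> (N <= l)%N -> normc (z k - z l) < e) ->
  exists l, forall e, 0 < e -> exists N, forall k, (N <= k)%N -> normc (z k - l) < e.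
Proof.
move=> cz.
have ReB (u v : C) : complex.Re (u - v) = complex.Re u - complex.Re v by case: u v => ? ? [].
have ImB (u v : C) : complex.Im (u - v) = complex.Im u - complex.Im v by case: u v => ? ? [].
have [|a aP] := @real_cauchy_limit R (fun k => complex.Re (z k)).
  move=> e /cz[N NP]; exists N => k l Nk Nl; rewrite -ReB.
  by apply: le_lt_trans (NP _ _ Nk Nl); apply: le_trans (ler_norm _) (ler_Re_normc _).
have [|b bP] := @real_cauchy_limit R (fun k => complex.Im (z k)).
  move=> e /cz[N NP]; exists N => k l Nk Nl; rewrite -ImB.
  by apply: le_lt_trans (NP _ _ Nk Nl); apply: le_trans (ler_norm _) (ler_Im_normc _).
exists (Complex a b) => e e0; have e20 : 0 < e / 2 by rewrite divr_gt0.
have [[N NP] [M MP]] := (aP _ e20, bP _ e20).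
exists (maxn N M) => k; rewrite geq_max => /andP[/NP h1 /MP h2].
apply: le_lt_trans (normc_Re_Im _) _; rewrite ReB ImB /=.
by rewrite (splitr e) ltrD.
Qed.

Lemma sqnorm_le (f : G -> C) (e : R) :
  (forall F : {fset G}, \sum_(g <- F) normc (f g) ^+ 2 <= e) -> (sqnorm f <= e%:E)%E.
Proof.
move=> fe; apply: ge_ereal_sup => _ [X [finX _] <-].
rewrite fsbig_finite//= sumEFin lee_fin; exact: fe.
Qed.

Lemma sum_normc_le (x : l2) (F : {fset G}) : \sum_(g <- F) normc (x g) ^+ 2 <= l2norm x ^+ 2.
Proof.
rewrite -lee_fin sqr_l2norm -sumEFin; apply: ereal_sup_ubound.
exists [set` F]%classic => //; rewrite fsbig_finite//=.
by rewrite set_fsetK.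
Qed.

(** The limit f is taken coordinatewise; it is square summable because u N and u N - f are. *)
Lemma l2_complete : rip_complete (@rip R G).
Proof.
move=> u cu.
have coord g : exists l, forall e, 0 < e ->
    exists N, forall k, (N <= k)%N -> normc (u k g - l) < e.
  apply: (complex_cauchy_limit (z := fun k => u k g)) => e e0.
  have [N NP] := cu (e ^+ 2) (exprn_gt0 _ e0).
  exists N => k l Nk Nl; have := NP _ _ Nk Nl; rewrite rip_norm ltr_pXn2r ?nnegrE ?l2norm_ge0 ?ltW//.
  exact: le_lt_trans (normc_coord (u k - u l) g).
have [f fP] := choice coord.
have fin_lim (F : {fset G}) (e : R) : 0 < e ->
    exists N, forall k, (N <= k)%N -> \sum_(g <- F) normc (u k g - f g) ^+ 2 <= e.
  elim: (F : seq G) e => [|g s IH] e e0.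
    by exists 0 => k _; rewrite big_nil ltW.
  have e20 : 0 < e / 2 by rewrite divr_gt0.
  have [N NP] := IH _ e20; have [M MP] := fP g (Num.sqrt (e / 2)) (ltac:(by rewrite sqrtr_gt0)).
  exists (maxn N M) => k; rewrite geq_max => /andP[/NP h1 /MP h2].
  rewrite big_cons (splitr e) lerD// -[leRHS]sqr_sqrtr ?(ltW e20)//.
  by rewrite ler_pXn2r ?nnegrE ?sqrtr_ge0 ?normc_ge0// ltW.
have lim (e : R) : 0 < e -> exists N, forall k, (N <= k)%N -> (sqnorm (fun g => u k g - f g)%R <= (3 * e)%:E)%E.
  move=> e0; have [N NP] := cu (e / 2) (ltac:(by rewrite divr_gt0)); exists N => k Nk.
  apply: sqnorm_le => F; have [M MP] := fin_lim F (e / 2) (ltac:(by rewrite divr_gt0)).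
  (* The index l depends on F, but the resulting bound 2 (e / 2) + 2 (e / 2) on the sum over F does
     not, so it passes to the supremum over F. *)
  pose l := maxn N M.
  have h1 := NP _ _ Nk (leq_maxl N M : (N <= l)%N); have h2 := MP _ (leq_maxr N M : (M <= l)%N).
  apply: (@le_trans _ _ (2 * \sum_(g <- F) normc ((u k - u l) g) ^+ 2 +
                         2 * \sum_(g <- F) normc (u l g - f g) ^+ 2)).
    rewrite !mulr_sumr -big_split /=; apply: ler_sum => g _.
    have -> : u k g - f g = (u k - u l) g + (u l g - f g) by rewrite !l2E addrA subrK.
    exact: sqr_normcD.
  have := sum_normc_le (u k - u l) F; rewrite -rip_norm.
  move: h1 h2; set a := \sum_(g <- F) _; set b := \sum_(g <- F) _; set c := rip _ _.
  lra.
have [N NP] := lim 1 ltr01.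
have x_l2 : l2_pred f.
  have d_l2 : l2_pred (fun g => u N g - f g).
    by apply/asboolP; apply: le_lt_trans (NP _ (leqnn N)) _; rewrite ltry.
  have : l2_pred (u N - L2 d_l2 : l2) by apply: l2P.
  by congr l2_pred; apply/funext => g; rewrite !l2E /= opprB addrC subrK.
exists (L2 x_l2) => e e0; have [M MP] := lim (e / 4) (ltac:(by rewrite divr_gt0)).
exists M => k /MP h; rewrite rip_norm.
have : l2norm (u k - L2 x_l2) ^+ 2 <= 3 * (e / 4) by rewrite -lee_fin sqr_l2norm.
by lra.
Qed.

End L2Complete.

(** * Projections in l^2(G)^n and their matrices *)

Section Amplification.
Variables (R : realType) (G : groupType) (n : nat).
Local Notation C := (R[i]).
Local Notation l2 := (l2 R G).
Local Notation W := ('I_n -> l2).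
Implicit Types (v w : W).

Definition ripW v w : R := \sum_i rip (v i) (w i).

Lemma ripWC v w : ripW v w = ripW w v.
Proof. by apply: eq_bigr => i _; rewrite ripC. Qed.

Lemma ripWDl v v' w : ripW (v + v') w = ripW v w + ripW v' w.
Proof. by rewrite /ripW -big_split; apply: eq_bigr => i _; exact: ripDl. Qed.

Lemma ripW0l w : ripW 0 w = 0.
Proof. by rewrite /ripW big1// => i _; rewrite /rip inner0l. Qed.

Lemma ripWZl (c : R) v w : ripW (c%:C%C *: v) w = c * ripW v w.
Proof. by rewrite /ripW mulr_sumr; apply: eq_bigr => i _; exact: ripZl. Qed.

Lemma ripW_ge0 v : 0 <= ripW v v.
Proof. by apply: sumr_ge0 => i _; exact: rip_ge0. Qed.

Lemma ripW_coord v i : l2norm (v i) ^+ 2 <= ripW v v.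
Proof.
rewrite /ripW (bigD1 i)//= rip_norm lerDl sumr_ge0// => j _; exact: rip_ge0.
Qed.

(** The denominator [n.+1] keeps the statement meaningful for n = 0. *)
Lemma ripW_lt v (e : R) : 0 < e -> (forall i, rip (v i) (v i) < e / n.+1%:R) -> ripW v v < e.
Proof.
move=> e0 ve; apply: (@le_lt_trans _ _ (\sum_(i < n) e / n.+1%:R)).
  by apply: ler_sum => i _; rewrite ltW.
rewrite sumr_const card_ord -[ltLHS]mulr_natr -mulrA gtr_pMr// mulrC ltr_pdivrMr ?ltr0n//.
by rewrite mul1r ltr_nat.
Qed.

Lemma ripW_complete : rip_complete ripW.
Proof.
move=> u cu.
have coord i : exists x, forall e, 0 < e -> exists N, forall k, (N <= k)%N ->
    rip (u k i - x) (u k i - x) < e.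
  apply: (l2_complete (u := fun k => u k i)) => e /cu[N NP]; exists N => k l Nk Nl.
  by apply: le_lt_trans (NP _ _ Nk Nl); rewrite rip_norm; exact: (ripW_coord (u k - u l) i).
have [x xP] := choice coord; exists x => e e0.
have en0 : 0 < e / n.+1%:R by rewrite divr_gt0// ltr0n.
have [N NP] := choice (fun i => xP i _ en0).
exists (\max_i N i)%N => k Nk; apply: ripW_lt => // i.
by apply: NP; apply: leq_trans Nk; exact: leq_bigmax.
Qed.

Section Projection.
Variable L : W -> Prop.
Hypotheses (L0 : L 0) (LD : forall v w, L v -> L w -> L (v + w))
  (LZ : forall (c : C) v, L v -> L (c *: v)).

Let is_proj v u := rip_closure ripW L u /\ forall w, L w -> ripW (v - u) w = 0.

Let proj_uniq v u u' : is_proj v u -> is_proj v u' -> u = u'.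
Proof.
move=> [cu ou] [cu' ou'].
have orth x : rip_closure ripW L x -> ripW (u - u') x = 0.
  move=> cx; have -> : u - u' = (v - u') - (v - u) by rewrite opprB [RHS]addrC addrA subrK.
  rewrite ripWDl (rip_Nl ripWDl).
  rewrite (closure_orth ripWC ripWDl ripWZl ripW_ge0 cx ou).
  by rewrite (closure_orth ripWC ripWDl ripWZl ripW_ge0 cx ou') subrr.
have : ripW (u - u') (u - u') = 0.
  by rewrite (rip_Dr ripWC ripWDl) (rip_Nr ripWC ripWDl) !orth// subrr.
move=> h; apply/funext => i; apply/eqP; rewrite -subr_eq0; apply/eqP/l2norm_eq0.
have := ripW_coord (u - u') i; rewrite h => h'.
by apply/eqP; rewrite -sqrf_eq0; apply/eqP/le_anti; rewrite h' sqr_ge0.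
Qed.

Let projT : {P : W -> W | forall v, is_proj v (P v)}.
Proof.
suff h v : exists u, is_proj v u by apply: cid; have [P PP] := choice h; exists P.
by apply: (projection_exists ripWC ripWDl ripWZl ripW_ge0 ripW_complete L0 LD) => c; exact: LZ.
Qed.

Let P := sval projT.
Let PP v : is_proj v (P v) := svalP projT v.

Let nsqZ (c : C) v : ripW (c *: v) (c *: v) = Normc.normc c ^+ 2 * ripW v v.
Proof.
by rewrite /ripW mulr_sumr; apply: eq_bigr => i _; rewrite !rip_norm l2normZ exprMn.
Qed.

(** Since L is stable under complex scalars, orthogonality for the real part of the inner product is
    stable too: the scalar moves to the other side as its conjugate. This makes the projection
    complex linear. *)
Let orthZ (c : C) v : (forall w, L w -> ripW v w = 0) -> forall w, L w -> ripW (c *: v) w = 0.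
Proof.
move=> ov w Lw.
have -> : ripW (c *: v) w = ripW v (conjc c *: w).
  apply: eq_bigr => i _; rewrite !ripE; congr rsum; apply/funext => g.
  rewrite -[(c *: v) i]/(c *: v i) -[(conjc c *: w) i]/(conjc c *: w i) !l2E.
  by case: (v i g) (w i g) (c) => a b [d e] [f h] /=; ring.
exact/ov/LZ.
Qed.

Let P_lin : linear P.
Proof.
move=> c v w; apply: (proj_uniq (PP _)).
have [[cv ov] [cw ow]] := (PP v, PP w); split.
  move=> e e0.
  (* After multiplication by |c|^2 this error is at most e / 4, also for c = 0; [nsqD_le] doubles
     both errors. *)
  have d0 : 0 < e / (4 * (Normc.normc c ^+ 2 + 1)).
    by rewrite divr_gt0// mulr_gt0// ltr_pwDr// sqr_ge0.
  have e40 : 0 < e / 4 by rewrite divr_gt0.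
  have [v' Lv' vv'] := cv _ d0; have [w' Lw' ww'] := cw _ e40.
  exists (c *: v' + w'); first by apply: LD => //; exact: LZ.
  have -> : c *: P v + P w - (c *: v' + w') = c *: (P v - v') + (P w - w').
    by rewrite scalerBr opprD addrACA.
  apply: le_lt_trans (nsqD_le ripWC ripWDl ripW_ge0 _ _) _; rewrite nsqZ.
  move: vv' ww'; set a := ripW _ _; set b := ripW _ _ => ha hb.
  have : Normc.normc c ^+ 2 * a <= e / 4.
    have -> : e / 4 = (Normc.normc c ^+ 2 + 1) * (e / (4 * (Normc.normc c ^+ 2 + 1))).
      by field; have := sqr_ge0 (Normc.normc c); lra.
    by apply: ler_pM; rewrite ?sqr_ge0 ?ripW_ge0 ?(ltW ha)// lerDl.
  lra.
move=> x Lx; have -> : c *: v + w - (c *: P v + P w) = c *: (v - P v) + (w - P w).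
  by rewrite scalerBr opprD addrACA.
by rewrite ripWDl orthZ// ow// addr0.
Qed.

Let P_le v : ripW (P v) (P v) <= ripW v v.
Proof.
have [cv ov] := PP v.
have o : ripW (v - P v) (P v) = 0 := closure_orth ripWC ripWDl ripWZl ripW_ge0 cv ov.
have : ripW v v = ripW (v - P v) (v - P v) + ripW (P v) (P v).
  have {1 2}-> : v = (v - P v) + P v by rewrite subrK.
  move: (v - P v) o => d o.
  rewrite ripWDl !(rip_Dr ripWC ripWDl) (ripWC (P v) d).
  by move: o; rewrite /ripW => ->; rewrite addr0 add0r.
by move=> ->; rewrite lerDr ripW_ge0.
Qed.

Let single j (x : l2) : W := fun i => if i == j then x else 0.

Let entry_bounded i j : bounded_linear (fun x => P (single j x) i).
Proof.
apply/asboolP; split.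
  move=> c x y; have -> : single j (c *: x + y) = c *: single j x + single j y.
    apply/funext => k; rewrite -[RHS]/(c *: single j x k + single j y k) /single.
    by case: ifP; rewrite // scaler0 addr0.
  by rewrite P_lin.
exists 1 => x; rewrite mul1r -(@ler_pXn2r _ 2)// ?nnegrE ?l2norm_ge0//.
apply: le_trans (ripW_coord _ _) _; apply: le_trans (P_le _) _.
rewrite /ripW (bigD1 j)//= big1 ?addr0 /single ?eqxx ?rip_norm//.
by move=> k /negPf ->; rewrite rip_norm -[0 : l2](scale0r 0) l2normZ Normc.normc0 mul0r expr0n.
Qed.

Let entry i j : bop R G := BOp (entry_bounded i j).

Let entryE v i : P v i = \sum_j entry i j (v j).
Proof.
have vE : v = \sum_j single j (v j).
  apply/funext => k; rewrite (bigD1 k)//= -[RHS]/(single k (v k) k + (\sum_(i0 < n | i0 != k) single i0 (v i0)) k).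
  have -> : (\sum_(i0 < n | i0 != k) single i0 (v i0)) k = \sum_(i0 < n | i0 != k) single i0 (v i0) k.
    exact: (big_morph (fun f : W => f k)).
  rewrite big1 ?addr0 /single ?eqxx// => j.
  by rewrite eq_sym => /negPf ->.
pose Pa := GRing.isLinear.Build C W W *:%R P P_lin.
pose PL : {linear W -> W} := HB.pack P Pa.
rewrite [in LHS]vE -[P _]/(PL _) raddf_sum.
exact: (big_morph (fun f : W => f i)).
Qed.

(** For the last clause: U preserves the closure of L, being isometric, and the orthogonal
    complement of L, since its adjoint U' preserves L. Hence U applied to the decomposition of v is
    the decomposition of U v, and the projection commutes with U acting on each coordinate. *)
Lemma projection_matrix : exists p : 'I_n -> 'I_n -> bop R G,
  [/\ forall v (e : R), 0 < e -> exists2 w, L w &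
        forall i, l2norm (\sum_j p i j (v j) - w i) < e,
      forall v, L v -> forall i, \sum_j p i j (v j) = v i &
      forall U U' : {additive l2 -> l2},
        (forall x, l2norm (U x) = l2norm x) ->
        (forall x y, rip (U x) y = rip x (U' y)) ->
        (forall v, L v -> L (fun i => U (v i))) ->
        (forall v, L v -> L (fun i => U' (v i))) ->
        forall i j x, p i j (U x) = U (p i j x)].
Proof.
exists entry; split.
- move=> v e e0; have [cv _] := PP v.
  have [w Lw h] := cv _ (exprn_gt0 2 e0); exists w => // i.
  rewrite -entryE -(@ltr_pXn2r _ 2)// ?nnegrE ?l2norm_ge0 ?(ltW e0)//.
  exact: le_lt_trans (ripW_coord (P v - w) i) h.
- move=> v Lv i; rewrite -entryE; congr (_ i); apply: (proj_uniq (PP v)); split.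
    by move=> e e0; exists v => //; rewrite subrr ripW0l.
  by move=> w Lw; rewrite subrr ripW0l.
- move=> U U' Un UU' LU LU' i j x.
  pose UW (v : W) : W := fun i => U (v i).
  have UP v : P (UW v) = UW (P v).
    have [cv ov] := PP v; apply: (proj_uniq (PP _)); split.
      move=> e /cv[w Lw h]; exists (UW w); first exact: LU.
      have -> : UW (P v) - UW w = UW (P v - w).
        by apply/funext => k; rewrite -[LHS]/(U (P v k) - U (w k)) -raddfB.
      apply: le_lt_trans h; rewrite le_eqVlt; apply/orP; left; apply/eqP.
      by apply: eq_bigr => k _; rewrite !rip_norm Un.
    move=> w Lw; have <- := ov _ (LU' _ Lw); apply: eq_bigr => k _.
    rewrite -[in RHS]UU'; congr (rip _ (w k)).
    by rewrite -[LHS]/(U (v k) - U (P v k)) -raddfB.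
  have -> : entry i j (U x) = P (UW (single j x)) i.
    congr (P _ i); apply/funext => k; rewrite /UW /single.
    by case: ifP => // _; rewrite raddf0.
  by rewrite UP.
Qed.

End Projection.
End Amplification.

(** * The double commutant theorem *)

Section Translations.
Variables (R : realType) (G : groupType).
Local Notation C := (R[i]).
Local Notation normc := (@Normc.normc R).
Local Notation l2 := (l2 R G).
Local Notation bop := (bop R G).
Implicit Types (x y z : l2) (g h k : G).

Lemma sqnorm_reindex (s t : G -> G) (f : G -> C) : cancel s t -> cancel t s ->
  sqnorm (fun g => f (s g)) = sqnorm f.
Proof.
move=> sK tK; rewrite /sqnorm; symmetry.
apply: (reindex_esum [set: G] [set: G] s).
by split=> //= [h k _ _|h _]; [exact: (can_inj sK)|exists (t h)].
Qed.

Lemma sqnorm_l2norm (x y : l2) : sqnorm x = sqnorm y -> l2norm x = l2norm y.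
Proof. by rewrite /l2norm => ->. Qed.

Let rtrans_subproof g x : l2_pred (fun h => x (h * g)%g).
Proof.
apply/asboolP; rewrite (@sqnorm_reindex _ (fun h => h * g^-1)%g x) ?l2_lt_pinfty//.
  exact: mulgK.
exact: mulgVK.
Qed.

Definition rtrans g x : l2 := L2 (rtrans_subproof g x).

Let rtrans_additive g : zmod_morphism (rtrans g).
Proof. by move=> x y; apply: l2_ext. Qed.

HB.instance Definition _ g := GRing.isZmodMorphism.Build l2 l2 (rtrans g) (rtrans_additive g).

Lemma rtransE g x h : rtrans g x h = x (h * g)%g.
Proof. by []. Qed.

Lemma transE g x h : trans R g x h = x (g^-1 * h)%g.
Proof. by []. Qed.

Lemma transK g : cancel (trans R g^-1%g) (trans R g).
Proof. by move=> x; apply: l2_ext => h; rewrite !transE invgK mulVKg. Qed.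

Lemma rtransK g : cancel (rtrans g^-1%g) (rtrans g).
Proof. by move=> x; apply: l2_ext => h; rewrite !rtransE mulgK. Qed.

Lemma l2norm_rtrans g x : l2norm (rtrans g x) = l2norm x.
Proof.
apply: sqnorm_l2norm.
by apply: (@sqnorm_reindex _ (fun h => h * g^-1)%g x); [exact: mulgK|exact: mulgVK].
Qed.

Lemma l2norm_trans g x : l2norm (trans R g x) = l2norm x.
Proof.
apply: sqnorm_l2norm.
by apply: (@sqnorm_reindex _ (fun h => g * h)%g x); [exact: mulVKg|exact: mulKg].
Qed.

Lemma rip_polar x y : 4 * rip x y = l2norm (x + y) ^+ 2 - l2norm (x - y) ^+ 2.
Proof.
have [C D] := (@ripC R G, @ripDl R G).
rewrite -!rip_norm !(ripDl, rip_Dr C D, rip_Nl D, rip_Nr C D) (ripC y x).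
ring.
Qed.

(** By polarization U preserves [rip], and y = U (U' y). *)
Lemma isometry_adjoint (U U' : {additive l2 -> l2}) :
  (forall x, l2norm (U x) = l2norm x) -> cancel U' U ->
  forall x y, rip (U x) y = rip x (U' y).
Proof.
move=> Un UK x y; have h4 : (4 : R) != 0 by rewrite pnatr_eq0.
apply: (mulfI h4); rewrite !rip_polar -{1 2}(UK y) -raddfD -raddfB.
by rewrite !Un.
Qed.

Lemma trans_delta g k : trans R g (delta R k) = delta R (g * k)%g.
Proof.
apply: l2_ext => h; rewrite transE /=; congr (_%:R); congr nat_of_bool.
by apply/eqP/eqP => [<-|->]; rewrite ?mulVKg ?mulKg.
Qed.

Lemma rtrans_delta g k : rtrans g (delta R k) = delta R (k * g^-1)%g.
Proof.
apply: l2_ext => h; rewrite rtransE /=; congr (_%:R); congr nat_of_bool.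
by apply/eqP/eqP => [<-|->]; rewrite ?mulgK ?mulgVK.
Qed.

Lemma normc_small (z : C) : (forall e, 0 < e -> normc z <= e) -> z = 0.
Proof.
move=> ze; apply: Normc.eq0_normc; apply/le_anti; rewrite normc_ge0 andbT.
by apply/ler_addgt0Pr => e e0; rewrite add0r; exact: ze.
Qed.

Lemma bop_coord_bounded (T : bop) : exists2 M : R, 0 < M & forall x h, normc (T x h) <= M * l2norm x.
Proof.
have [M M0 TM] := bop_bounded T; exists (M + 1); first by rewrite ltr_wpDl.
move=> x h; apply: le_trans (normc_coord _ _) _; apply: le_trans (TM x) _.
by rewrite ler_wpM2r ?l2norm_ge0// lerDl.
Qed.

Lemma bopB (T : bop) x y : T (x - y) = T x - T y.
Proof. exact: raddfB. Qed.

Lemma bop_sum (T : bop) I (r : seq I) (F : I -> l2) :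
  T (\sum_(i <- r) F i) = \sum_(i <- r) T (F i).
Proof. exact: raddf_sum. Qed.

Lemma bopZ (T : bop) c x : T (c *: x) = c *: T x.
Proof. exact: linearZ. Qed.

(** Finite combinations of the [delta R g] are dense, and each coordinate of a bounded operator is
    continuous. *)
Lemma bop_delta_ext (T U : bop) : (forall g, T (delta R g) = U (delta R g)) -> T = U.
Proof.
move=> TU; apply/eqP; rewrite -subr_eq0; apply/eqP; apply: bop_ext => x.
apply: l2_ext => h; apply: normc_small => e e0.
have [M M0 TM] := bop_coord_bounded (T - U).
have [X XP] := l2_approx x (divr_gt0 e0 M0).
have := XP X (fsubset_refl X); set s := \sum_(g <- X) _ => sX.
have -> : (T - U) x = (T - U) (x - s).
  rewrite [RHS]bopB [X in _ = _ - X](_ : _ = 0) ?subr0// /s bop_sum big1// => g _.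
  by rewrite bopZ bopE TU subrr scaler0.
apply: le_trans (TM _ _) _; rewrite -ler_pdivlMl// ltW// mulrC.
exact: sX.
Qed.

(* Compare the matrix coefficients at (h, g): both are limits of the same finite
   sums, after the substitution k |-> h k^-1 g. *)
Theorem commutation (A T : bop) :
  (forall g x, A (trans R g x) = trans R g (A x)) ->
  (forall g x, T (rtrans g x) = rtrans g (T x)) -> A * T = T * A.
Proof.
move=> At Tr; apply: bop_delta_ext => g; apply: l2_ext => h; rewrite !bopE.
(* The matrix coefficient of A at (h', k) depends only on k^-1 h', that of T only on h' k^-1. *)
have AE k h' : A (delta R k) h' = A (delta R 1%g) (k^-1 * h')%g.
  by rewrite -transE -At trans_delta mulg1.
have TE k h' : T (delta R k) h' = T (delta R 1%g) (h' * k^-1)%g.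
  by rewrite -rtransE -Tr rtrans_delta invgK mul1g.
apply/eqP; rewrite -subr_eq0; apply/eqP; apply: normc_small => e e0.
have [M M0 AM] := bop_coord_bounded A; have [N N0 TN] := bop_coord_bounded T.
set v := T (delta R g); set w := A (delta R g).
have eM : 0 < e / 2 / M by rewrite !divr_gt0.
have eN : 0 < e / 2 / N by rewrite !divr_gt0.
have [X XP] := l2_approx v eM; have [Y YP] := l2_approx w eN.
pose s k := (h * k^-1 * g)%g; pose t k := (g * k^-1 * h)%g.
have sK : cancel s t by move=> k; rewrite /s /t !invgM invgK !mulgA mulgV mul1g mulgVK.
have tK : cancel t s by move=> k; rewrite /s /t !invgM invgK !mulgA mulgV mul1g mulgVK.
(* F has to be large enough for v while its image under t is large enough for w; the two truncated
   sums then agree term by term. *)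
have [F XF YF'] : exists2 F, (X `<=` F)%fset & (Y `<=` [fset t k | k in F])%fset.
  exists (X `|` [fset s k | k in Y])%fset; first exact: fsubsetUl.
  apply/fsubsetP => k kY; apply/imfsetP; exists (s k); rewrite ?sK//=.
  by rewrite inE; apply/orP; right; apply/imfsetP; exists k.
pose vF := \sum_(k <- F) v k *: delta R k; pose wF := \sum_(k <- [fset t k | k in F]%fset) w k *: delta R k.
have eqF : A vF h = T wF h.
  rewrite /vF /wF !bop_sum !l2_sumE [RHS]big_imfset /=; last by move=> ? ? _ _; exact: (can_inj tK).
  apply: eq_bigr => k _; rewrite !bopZ !l2E mulrC (AE k) (TE (t k)) /v /w (AE g) (TE g) /t.
  by rewrite !invgM !invgK !mulgA mulVg mul1g mulgV mul1g.
have -> : A v h - T w h = A (v - vF) h - T (w - wF) h.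
  by rewrite !bopB !l2E eqF opprB addrA subrK.
apply: le_trans (le_normcD _ _) _; rewrite normcN (splitr e); apply: lerD.
  by apply: le_trans (AM _ _) _; rewrite mulrC -ler_pdivlMr// ltW// XP.
by apply: le_trans (TN _ _) _; rewrite mulrC -ler_pdivlMr// ltW// YP.
Qed.

End Translations.

Section Bicommutant.
Variables (R : realType) (G : groupType).
Local Notation C := (R[i]).
Local Notation normc := (@Normc.normc R).
Local Notation l2 := (l2 R G).
Local Notation bop := (bop R G).

Lemma lregE (a : grpring C G) (x : l2) h :
  lreg a x h = \sum_(k <- msupp a) mcoeff k a * x (k^-1 * h)%g.
Proof. by rewrite /lreg bop_sumE l2_sumE; apply: eq_bigr => k _; rewrite bopE. Qed.

Lemma lreg_scalar (c : C) (x : l2) : lreg (mkmalgU 1%g c) x = c *: x.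
Proof.
apply: l2_ext => h; rewrite lregE msuppU; case: eqP => [->|_].
  by rewrite big_seq_fset0 scale0r.
by rewrite big_seq_fset1 mcoeffUU invg1 mul1g.
Qed.

(** Elements of C[G] act by left translations, which commute with right ones. Testing against
    [delta R h] and [delta R (h * g)] controls the two coordinates to be compared. *)
Lemma weak_closure_rtrans (T : bop) : weak_closure T ->
  forall g x, T (rtrans g x) = rtrans g (T x).
Proof.
move=> /asboolP wT g x; apply: l2_ext => h.
apply/eqP; rewrite -subr_eq0; apply/eqP; apply: normc_small => e e0.
have [a aP] := wT [:: (rtrans g x, delta R h); (x, delta R (h * g)%g)] (e / 2)
  (ltac:(by rewrite divr_gt0)).
have := aP _ (mem_head _ _); rewrite inner_delta /= => h1.
have := aP (x, delta R (h * g)%g); rewrite inner_delta /= => /(_ _) h2.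
have -> : T (rtrans g x) h - rtrans g (T x) h =
    (T - lreg a) (rtrans g x) h - (T - lreg a) x (h * g)%g.
  rewrite !bopE !l2E rtransE; have -> : lreg a (rtrans g x) h = lreg a x (h * g)%g.
    by rewrite !lregE; apply: eq_bigr => k _; rewrite rtransE mulgA.
  by rewrite opprB addrA subrK.
apply: le_trans (le_normcD _ _) _; rewrite normcN (splitr e) lerD ?ltW//.
by apply: h2; rewrite !inE eqxx orbT.
Qed.

(* Double commutant: approximate T simultaneously on x_1, ..., x_n by projecting
   onto the closure of C[G] (x_1, ..., x_n); the entries of the projection commute
   with left translations, hence with T. *)
Theorem rtrans_weak_closure (T : bop) :
  (forall g x, T (rtrans g x) = rtrans g (T x)) -> weak_closure T.
Proof.
move=> Tr; apply/asboolP => s e e0.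
pose n := size s; pose x (i : 'I_n) := (tnth (in_tuple s) i).1.
pose y (i : 'I_n) := (tnth (in_tuple s) i).2.
pose L (w : 'I_n -> l2) := exists a : grpring C G, forall i, w i = lreg a (x i).
have [|v w [a va] [b wb]|c v [a va]|p [pcl pid pcomm]] := @projection_matrix R G n L.
- by exists 0 => i; rewrite raddf0.
- by exists (a + b) => i; rewrite raddfD bopE -va -wb.
- by exists ((mkmalgU 1%g c : grpring C G) * a) => i; rewrite rmorphM bopE -va lreg_scalar.
have pT i j : p i j * T = T * p i j.
  apply: commutation => // g z.
  apply: (pcomm (trans R g) (trans R g^-1%g)).
  - exact: l2norm_trans.
  - apply: isometry_adjoint; first exact: l2norm_trans.
    exact: transK.
  - by move=> v [a va]; exists (gr_unit C g * a) => k; rewrite rmorphM /= lreg_unit va.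
  - by move=> v [a va]; exists (gr_unit C g^-1%g * a) => k; rewrite rmorphM /= lreg_unit va.
(* The vector x is in L, taking a = 1, so p fixes it; as T commutes with the entries of p, the
   vector (T x_i) lies in the closure of L. *)
have Tx i : T (x i) = \sum_j p i j (T (x j)).
  have Lx : L x by exists 1 => k; rewrite rmorph1.
  rewrite -{1}(pid _ Lx i) bop_sum; apply: eq_bigr => j _.
  exact: (congr1 (fun B : bop => B (x j)) (esym (pT i j))).
pose Y := \sum_i l2norm (y i).
have Y0 : 0 <= Y by apply: sumr_ge0 => i _; exact: l2norm_ge0.
(* The 2 absorbs the factor in [normc_inner_le], and Y bounds every ||y_i||. *)
have d0 : 0 < e / (2 * (Y + 1)) by rewrite divr_gt0// mulr_gt0// ltr_wpDl.
have [w [a wa] h] := pcl (fun j => T (x j)) _ d0.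
exists a => q /(tnthP (in_tuple s)) [i ->].
apply: le_lt_trans (normc_inner_le _ _) _.
rewrite -/(x i) -/(y i) !bopE -wa Tx; have := h i.
have : l2norm (y i) <= Y.
  by rewrite /Y (bigD1 i)//= lerDl sumr_ge0// => j _; exact: l2norm_ge0.
move: (l2norm_ge0 (\sum_j p i j (T (x j)) - w i)) (l2norm_ge0 (y i)).
set u := l2norm _; set v := l2norm _ => u0 v0 vY ud.
rewrite mulrC -ltr_pdivlMr//; apply: (@le_lt_trans _ _ (u * Y)).
  by rewrite ler_wpM2l.
have -> : e / 2 = e / (2 * (Y + 1)) * (Y + 1) by field; lra.
apply: (@le_lt_trans _ _ (e / (2 * (Y + 1)) * Y)).
  by rewrite ler_wpM2r// ltW.
by rewrite ltr_pM2l// ltrDl.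
Qed.

End Bicommutant.

(** * Group von Neumann algebras of subgroups *)

Section Subgroup.
Variables (G : groupType) (S : pred G) (D : subGroupType S).
Implicit Types (g h : G) (d : D).

Lemma subgroupP g : reflect (exists d, g = val d) (S g).
Proof.
apply: (iffP idP) => [Sg|[d ->]]; last exact: valP.
by exists (Sub g Sg); rewrite SubK.
Qed.

Lemma subgroup_val d : S (val d). Proof. exact: valP. Qed.

Lemma subgroupM g h : S g -> S h -> S (g * h)%g.
Proof.
by move=> /subgroupP[d ->] /subgroupP[d' ->]; apply/subgroupP; exists (d * d')%g; rewrite valM.
Qed.

Lemma valVg d : val d^-1%g = (val d)^-1%g.
Proof. by apply: (mulgI (val d)); rewrite -valM !mulgV val1. Qed.

Lemma subgroupV g : S g -> S g^-1%g.
Proof. by move=> /subgroupP[d ->]; apply/subgroupP; exists d^-1%g; rewrite valVg. Qed.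

Lemma subgroup1 : S 1%g.
Proof. by apply/subgroupP; exists 1%g; rewrite val1. Qed.

(** The predicate describes the right coset S h. As [choose] depends neither on the presentation of
    the predicate nor on the witness, the result depends on the coset only. *)
Definition coset_rep h : G := choose (fun k => S (k * h^-1)%g) h.

Lemma coset_repP h : S (coset_rep h * h^-1)%g.
Proof. by rewrite /coset_rep; apply: (@chooseP _ (fun k => S (k * h^-1)%g) h); rewrite mulgV subgroup1. Qed.

Lemma coset_rep_eq h h' : S (h * h'^-1)%g -> coset_rep h = coset_rep h'.
Proof.
move=> Shh'; rewrite /coset_rep.
have eqP : (fun k => S (k * h^-1)%g) =1 (fun k => S (k * h'^-1)%g).
  move=> k; apply/idP/idP => Sk.
    have -> : (k * h'^-1 = (k * h^-1) * (h * h'^-1))%g by rewrite mulgA mulgVK.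
    exact: subgroupM.
  have -> : (k * h^-1 = (k * h'^-1) * (h * h'^-1)^-1)%g by rewrite invgM invgK mulgA mulgVK.
  by apply: subgroupM => //; exact: subgroupV.
rewrite (eq_choose eqP); apply: choose_id => //.
by rewrite mulgV subgroup1.
Qed.

Lemma coset_rep_idem h : coset_rep (coset_rep h) = coset_rep h.
Proof. exact/coset_rep_eq/coset_repP. Qed.

Lemma coset_repMl d h : coset_rep (val d * h)%g = coset_rep h.
Proof. by apply: coset_rep_eq; rewrite mulgK subgroup_val. Qed.

End Subgroup.

(** * Restriction to cosets and extension by zero *)

Section Induction.
Variables (R : realType) (G : groupType) (S : pred G) (D : subGroupType S).
Local Notation C := (R[i]).
Local Notation normc := (@Normc.normc R).
Implicit Types (g h : G) (d : D) (x y : l2 R G) (v w : l2 R D).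

Lemma esum_val (f : D -> \bar R) (F : G -> \bar R) : (forall d, F (val d) = f d) ->
  (forall g, ~~ S g -> F g = 0%E) ->
  \esum_(g in [set: G]) F g = \esum_(d in [set: D]) f d.
Proof.
move=> Ff F0; have bij : set_bij [set: D] [set g | S g]%classic (val : D -> G).
  split=> [d _|d d' _ _|g Sg] /=; first exact: subgroup_val.
    exact: val_inj.
  by move: (Sg) => /(subgroupP D)[d ->]; exists d.
transitivity (\esum_(g in [set g | S g]%classic) F g).
  rewrite [RHS]esum_mkcond; apply: eq_esum => g _; case: ifPn => //.
  move=> h; apply: F0; apply: contra h => Sg; by rewrite inE.
by rewrite (reindex_esum _ _ _ _ bij); apply: eq_esum => d _; rewrite Ff.
Qed.

Let slice_subproof h x : l2_pred (fun d : D => x (val d * h)%g).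
Proof.
apply/asboolP; have := l2_lt_pinfty (rtrans h x); apply: le_lt_trans.
pose F g : \bar R := if S g then (normc (x (g * h)%g) ^+ 2)%:E else 0%E.
rewrite /sqnorm -(@esum_val _ F).
- by apply: le_esum => g _; rewrite /F; case: ifP => // _; rewrite lee_fin sqr_ge0.
- by move=> d; rewrite /F subgroup_val.
- by move=> g /negPf; rewrite /F => ->.
Qed.

Definition slice h x : l2 R D := L2 (slice_subproof h x).

Let ext_subproof w : l2_pred (fun g => if insub g is Some d then w d else 0 : C).
Proof.
apply/asboolP; have := l2_lt_pinfty w; apply: le_lt_trans.
rewrite le_eqVlt; apply/orP; left; apply/eqP; apply: esum_val.
  by move=> d; rewrite valK.
by move=> g Sg; rewrite insubN// Normc.normc0 expr0n.
Qed.

Definition l2_ext0 w : l2 R G := L2 (ext_subproof w).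

Lemma l2_ext0_val w d : l2_ext0 w (val d) = w d.
Proof. by rewrite /= valK. Qed.

Lemma l2_ext0_out w g : ~~ S g -> l2_ext0 w g = 0.
Proof. by move=> Sg; rewrite /= insubN. Qed.

Lemma l2norm_ext0 w : l2norm (l2_ext0 w) = l2norm w.
Proof.
rewrite /l2norm; congr (Num.sqrt (fine _)); apply: esum_val.
  by move=> d; rewrite l2_ext0_val.
by move=> g Sg; rewrite l2_ext0_out// Normc.normc0 expr0n.
Qed.

Lemma l2norm_slice h x : l2norm (slice h x) <= l2norm x.
Proof.
rewrite -(l2norm_rtrans h x) -(@ler_pXn2r _ 2)// ?nnegrE ?l2norm_ge0//.
rewrite -lee_fin !sqr_l2norm.
pose F g : \bar R := if S g then (normc (x (g * h)%g) ^+ 2)%:E else 0%E.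
rewrite /sqnorm -(@esum_val _ F).
- by apply: le_esum => g _; rewrite /F; case: ifP => // _; rewrite lee_fin sqr_ge0.
- by move=> d; rewrite /F subgroup_val.
- by move=> g /negPf; rewrite /F => ->.
Qed.

Lemma sliceE h x d : slice h x d = x (val d * h)%g.
Proof. by []. Qed.

Lemma slice_linear h : linear (slice h).
Proof. by move=> c x y; apply: l2_ext. Qed.

Lemma ext0_linear : linear l2_ext0.
Proof.
move=> c v w; apply: l2_ext => g.
have [/(subgroupP D)[d ->]|Sg] := boolP (S g); first by rewrite !l2E !l2_ext0_val.
by rewrite !l2E !l2_ext0_out// mulr0 addr0.
Qed.

HB.instance Definition _ h := GRing.isLinear.Build C (l2 R G) (l2 R D) *:%R (slice h) (slice_linear h).
HB.instance Definition _ := GRing.isLinear.Build C (l2 R D) (l2 R G) *:%R l2_ext0 ext0_linear.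

Lemma slice_rtrans h g x : slice h (rtrans g x) = slice (h * g)%g x.
Proof. by apply: l2_ext => d; rewrite !sliceE rtransE mulgA. Qed.

Lemma rtrans_slice h d x : rtrans d (slice h x) = slice (val d * h)%g x.
Proof. by apply: l2_ext => d'; rewrite rtransE !sliceE valM mulgA. Qed.

Lemma slice_trans h d x : slice h (trans R (val d) x) = trans R d (slice h x).
Proof. by apply: l2_ext => d'; rewrite transE !sliceE transE valM valVg mulgA. Qed.

Lemma slice_ext0 d w : slice (val d) (l2_ext0 w) = rtrans d w.
Proof. by apply: l2_ext => d'; rewrite sliceE -valM l2_ext0_val. Qed.

Lemma slice_ext0_out h w : ~~ S h -> slice h (l2_ext0 w) = 0.
Proof.
move=> Sh; apply: l2_ext => d; rewrite sliceE l2_ext0_out//.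
apply: contra Sh => Sdh; have -> : (h = (val d)^-1 * (val d * h))%g by rewrite mulKg.
apply: (subgroupM D) => //; exact: (subgroupV D (subgroup_val d)).
Qed.

Lemma ext0_trans d w : l2_ext0 (trans R d w) = trans R (val d) (l2_ext0 w).
Proof.
apply: l2_ext => g; rewrite transE; have [/(subgroupP D)[d' ->]|Sg] := boolP (S g).
  by rewrite -valVg -valM !l2_ext0_val transE.
rewrite !l2_ext0_out//; apply: contra Sg => Sdg.
have -> : (g = val d * ((val d)^-1 * g))%g by rewrite mulVKg.
by apply: (subgroupM D) => //; exact: subgroup_val.
Qed.

Lemma ext0_rtrans d w : l2_ext0 (rtrans d w) = rtrans (val d) (l2_ext0 w).
Proof.
apply: l2_ext => g; rewrite rtransE; have [/(subgroupP D)[d' ->]|Sg] := boolP (S g).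
  by rewrite -valM !l2_ext0_val rtransE.
rewrite !l2_ext0_out//; apply: contra Sg => Sdg.
have -> : (g = (g * val d) * (val d)^-1)%g by rewrite mulgK.
by apply: (subgroupM D) => //; exact: (subgroupV D (subgroup_val d)).
Qed.

(** Every g is uniquely d t with d in D and t a representative. The sum runs over all of G, with
    zeros off the representatives, to fit [esumZ_fin]. *)
Lemma sqnorm_cosets (f : G -> C) : sqnorm f = \esum_(t in [set: G])
  (if coset_rep S t == t then sqnorm (fun d : D => f (val d * t)%g) else 0%E).
Proof.
pose I := [set t | coset_rep S t == t]%classic.
transitivity (\esum_(t in I) sqnorm (fun d : D => f (val d * t)%g)); last first.
  rewrite esum_mkcond; apply: eq_esum => t _.
  have -> : (t \in I) = (coset_rep S t == t) by apply/idP/idP; rewrite inE.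
  by [].
rewrite /sqnorm (esum_esum (J := fun=> [set: D]%classic)); last first.
  by move=> i j _ _; rewrite lee_fin sqr_ge0.
apply: (reindex_esum _ _ (fun k : G * D => (val k.2 * k.1)%g)).
split=> [//|[t d] [t' d'] /set_mem[/eqP/= rt _] /set_mem[/eqP/= rt' _] /= e|g _] /=.
  have tt' : t = t' by rewrite -rt -rt' -(coset_repMl d t) e coset_repMl.
  by move: e; rewrite tt' => /mulIg/val_inj ->.
have Sg : S (g * (coset_rep S g)^-1)%g.
  rewrite -[g in (g * _)%g]invgK -invgM; apply: (subgroupV D); exact: (coset_repP D).
have [d dE] := elimT (subgroupP D _) Sg; exists (coset_rep S g, d); last by rewrite /= -dE mulgVK.
by split=> //=; apply/eqP; exact: (coset_rep_idem D).
Qed.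

End Induction.

Section GroupVN.
Variables (R : realType) (G : groupType).
Implicit Types (T U : vN R G) (g h : G) (x : l2 R G).

Lemma vN_ext T U : (forall x, T x = U x) -> T = U.
Proof. by move=> TU; apply/val_inj/bop_ext. Qed.

Lemma vN_rtrans T g x : T (rtrans g x) = rtrans g (T x).
Proof. by apply: weak_closure_rtrans; exact: vNP. Qed.

(** Every [delta R g] is a right translate of [delta R 1], and elements of N(G) commute with right
    translations. *)
Lemma vN_delta1_ext T U : T (delta R 1%g) = U (delta R 1%g) -> T = U.
Proof.
move=> TU; apply/val_inj/bop_delta_ext => g.
have -> : delta R g = rtrans g^-1%g (delta R 1%g) by rewrite rtrans_delta invgK mul1g.
by rewrite !vN_rtrans TU.
Qed.

Lemma vNE : (forall x, (0 : vN R G) x = 0) * (forall x, (1 : vN R G) x = x) *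
  (forall T U x, (T + U) x = T x + U x) * (forall T x, (- T) x = - T x) *
  (forall T U x, (T * U) x = T (U x)).
Proof. by []. Qed.

Lemma vN_sumE I (r : seq I) (F : I -> vN R G) (x : l2 R G) : (\sum_(i <- r) F i) x = \sum_(i <- r) F i x.
Proof. by elim/big_rec2: _ => // i y T _ <-. Qed.

Lemma vN_unitE g x : vN_unit R g x = trans R g x.
Proof. by []. Qed.

Lemma vN_unitM g h : vN_unit R (g * h)%g = vN_unit R g * vN_unit R h.
Proof. by apply/val_inj; exact: transM. Qed.

Lemma vN_of_unit g : vN_of R (gr_unit int g) = vN_unit R g.
Proof. by rewrite /vN_of gr_liftU mul1r. Qed.

End GroupVN.

Lemma grpring_ext (G : groupType) (V : zmodType) (f f' : grpring int G -> V) :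
  zmod_morphism f -> zmod_morphism f' ->
  (forall g, f (gr_unit int g) = f' (gr_unit int g)) -> f =1 f'.
Proof.
move=> fB fB' ff' a.
pose fa := GRing.isZmodMorphism.Build _ _ f fB.
pose F : {additive grpring int G -> V} := HB.pack f fa.
pose fa' := GRing.isZmodMorphism.Build _ _ f' fB'.
pose F' : {additive grpring int G -> V} := HB.pack f' fa'.
rewrite -[f a]/(F a) -[f' a]/(F' a) [a]monalgE !raddf_sum; apply: eq_bigr => g _.
have -> z : mkmalgU g z = gr_unit int g *~ z :> grpring int G.
  apply/malgP => k; rewrite raddfMz /= !mcoeffU.
  by case: eqP => _; rewrite ?mulr0n ?mulr1n ?mul0rz ?intz.
by rewrite !raddfMz /= ff'.
Qed.

Lemma gr_incl_unit (G : groupType) (S : pred G) (D : subGroupType S) (d : D) :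
  gr_incl (gr_unit int d) = gr_unit int (val d).
Proof. by rewrite /gr_incl gr_liftU mul1r. Qed.

(** * The embedding of N(D) into N(G) and the conditional expectation *)

Section Induction.
Variables (R : realType) (G : groupType) (S : pred G) (D : subGroupType S).
Local Notation C := (R[i]).
Local Notation normc := (@Normc.normc R).
Implicit Types (g h : G) (d : D) (T U : vN R D).

(* T acts on l^2(G) = (+) l^2(D t) through each right coset D t; commutation with
   right translations makes the formula independent of coset representatives. *)
Let ind_subproof1 T : exists2 M : R, 0 <= M & forall x : l2 R G,
  (sqnorm (fun h => T (slice D h x) 1%g) <= (M ^+ 2 * l2norm x ^+ 2)%:E)%E.
Proof.
have [M M0 TM] := bop_bounded T; exists M => // y.
rewrite (sqnorm_cosets D) EFinM sqr_l2norm (sqnorm_cosets D y).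
pose a t := if coset_rep S t == t then l2norm (slice D t y) ^+ 2 else 0.
have -> : \esum_(t in [set: G])
   (if coset_rep S t == t then sqnorm (fun d : D => y (val d * t)%g) else 0%E) =
   \esum_(t in [set: G]) (a t)%:E.
  by apply: eq_esum => t _; rewrite /a; case: ifP => // _; rewrite sqr_l2norm.
rewrite -esumZ_fin ?sqr_ge0//; last by move=> t; rewrite /a; case: ifP => _ //; rewrite sqr_ge0.
apply: le_esum => t _; rewrite /a; case: ifP => _; last by rewrite mulr0.
(* Changing t to d t right-translates the slice by d, so on the coset D t the values at 1 assemble
   to T (slice t y), whose norm T bounds. *)
have -> : (fun d : D => T (slice D (val d * t)%g y) 1%g) = T (slice D t y) :> (D -> C).
  by apply/funext => d; rewrite -rtrans_slice vN_rtrans rtransE mul1g.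
rewrite -sqr_l2norm lee_fin -exprMn ler_pXn2r ?nnegrE ?mulr_ge0 ?l2norm_ge0//.
Qed.

Let ind_subproof2 T (x : l2 R G) : l2_pred (fun h => T (slice D h x) 1%g).
Proof.
have [M _ le] := ind_subproof1 T.
by apply/asboolP; apply: le_lt_trans (le x) _; rewrite ltry.
Qed.

Definition ind_fun T x : l2 R G := L2 (ind_subproof2 T x).

Lemma ind_funE T x h : ind_fun T x h = T (slice D h x) 1%g.
Proof. by []. Qed.

Let ind_subproof3 T : bounded_linear (ind_fun T).
Proof.
apply/asboolP; split.
  by move=> c x y; apply: l2_ext => h; rewrite l2E l2E !ind_funE !linearP l2E l2E.
have [M M0 le] := ind_subproof1 T; exists M => x.
rewrite -(@ler_pXn2r _ 2)// ?nnegrE ?mulr_ge0 ?l2norm_ge0// exprMn.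
by rewrite -lee_fin sqr_l2norm; exact: le.
Qed.

Let ind_subproof4 T : weak_closure (BOp (ind_subproof3 T)).
Proof.
apply: rtrans_weak_closure => g x; apply: l2_ext => h.
by rewrite rtransE !ind_funE slice_rtrans.
Qed.

Definition vN_ind T : vN R G := VN (ind_subproof4 T).

Lemma vN_indE T x h : vN_ind T x h = T (slice D h x) 1%g.
Proof. by []. Qed.

Lemma slice_ind T x h : slice D h (vN_ind T x) = T (slice D h x).
Proof.
apply: l2_ext => d; rewrite sliceE vN_indE -rtrans_slice vN_rtrans rtransE.
by rewrite mul1g.
Qed.

Let vN_indB : zmod_morphism vN_ind.
Proof. by move=> T U; apply: vN_ext => x; apply: l2_ext. Qed.

Let vN_indM : monoid_morphism vN_ind.
Proof.
split=> [|T U]; apply: vN_ext => x; apply: l2_ext => h; rewrite vN_indE.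
  by rewrite vNE sliceE val1 mul1g.
by rewrite !vNE vN_indE slice_ind.
Qed.

HB.instance Definition _ := GRing.isZmodMorphism.Build _ _ vN_ind vN_indB.
HB.instance Definition _ := GRing.isMonoidMorphism.Build _ _ vN_ind vN_indM.

Lemma vN_ind_unit d : vN_ind (vN_unit R d) = vN_unit R (val d).
Proof.
apply: vN_ext => x; apply: l2_ext => h; rewrite vN_indE !vN_unitE -slice_trans.
by rewrite sliceE val1 mul1g.
Qed.

Lemma vN_ind_of (a : grpring int D) : vN_ind (vN_of R a) = vN_of R (gr_incl a).
Proof.
move: a; apply: (@grpring_ext D _ (fun a => vN_ind (vN_of R a)) (fun a => vN_of R (@gr_incl G S D a))).
- by move=> x y; rewrite /= !raddfB.
- by move=> x y; rewrite /= !raddfB.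
- by move=> d; rewrite /= gr_incl_unit !vN_of_unit vN_ind_unit.
Qed.

Lemma vN_ind_ext0 T w : vN_ind T (l2_ext0 w) = l2_ext0 (T w).
Proof.
apply: l2_ext => h; rewrite vN_indE; have [/(subgroupP D)[d ->]|Sh] := boolP (S h).
  by rewrite slice_ext0 vN_rtrans rtransE mul1g l2_ext0_val.
by rewrite slice_ext0_out// raddf0 l2_ext0_out.
Qed.

(* The conditional expectation N(G) -> N(D). *)
Let exp_subproof1 (T : vN R G) : bounded_linear (fun w : l2 R D => slice D 1%g (T (l2_ext0 w))).
Proof.
apply/asboolP; split; first by move=> c v w; rewrite !linearP.
have [M M0 TM] := bop_bounded T; exists M => w.
by apply: le_trans (l2norm_slice _ _ _) _; apply: le_trans (TM _) _; rewrite l2norm_ext0.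
Qed.

Let exp_subproof2 (T : vN R G) : weak_closure (BOp (exp_subproof1 T)).
Proof.
apply: rtrans_weak_closure => d w /=.
by rewrite ext0_rtrans vN_rtrans slice_rtrans rtrans_slice mul1g mulg1.
Qed.

Definition vN_exp (T : vN R G) : vN R D := VN (exp_subproof2 T).

Lemma vN_expE (T : vN R G) w : vN_exp T w = slice D 1%g (T (l2_ext0 w)).
Proof. by []. Qed.

Lemma vN_expB : zmod_morphism vN_exp.
Proof. by move=> T U; apply: vN_ext => w; apply: l2_ext. Qed.

HB.instance Definition _ := GRing.isZmodMorphism.Build _ _ vN_exp vN_expB.

Lemma vN_exp_indMl T (U : vN R G) : vN_exp (vN_ind T * U) = T * vN_exp U.
Proof. by apply: vN_ext => w; rewrite vN_expE !vNE slice_ind. Qed.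

Lemma vN_exp_unitMr (T : vN R G) d : vN_exp (T * vN_unit R (val d)) = vN_exp T * vN_unit R d.
Proof.
apply: vN_ext => w; rewrite [in RHS]vNE !vN_expE vNE.
by rewrite !vN_unitE ext0_trans.
Qed.

Lemma vN_exp_unit g : ~~ S g -> vN_exp (vN_unit R g) = 0.
Proof.
move=> Sg; apply: vN_ext => w; apply: l2_ext => d.
rewrite vN_expE sliceE vN_unitE transE mulg1 vNE l2E l2_ext0_out//.
apply: contra Sg => Sgd.
have -> : (g = val d * (g^-1 * val d)^-1)%g by rewrite invgM invgK mulVKg.
by apply: (subgroupM D); [exact: subgroup_val|exact: (subgroupV D)].
Qed.

Lemma vN_exp1 : vN_exp 1 = 1.
Proof.
apply: vN_ext => w; apply: l2_ext => d.
by rewrite vN_expE sliceE !vNE mulg1 l2_ext0_val.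
Qed.

End Induction.

(** The equational criterion for flatness, with c square because it will be a projection. The
    columns of a are indexed by elements of a type K since they will be the module elements supplied
    by [tens_map_eq0]. *)
Definition equationally_flat (M N : pzRingType) (f : {rmorphism M -> N}) :=
  forall (n : nat) (K : eqType) (b : 'I_n -> N) (a : 'I_n -> K -> M) (ms : seq K),
  (forall m, m \in ms -> \sum_i b i * f (a i m) = 0) ->
  exists c : 'I_n -> 'I_n -> M,
    (forall i, b i = \sum_l b l * f (c l i)) /\
    (forall l m, m \in ms -> \sum_i c l i * a i m = 0).

Section Flatness.
Variables (R : realType) (G : groupType) (S : pred G) (D : subGroupType S).
Local Notation C := (R[i]).
Local Notation normc := (@Normc.normc R).
Local Notation l2D := (l2 R D).
Local Notation ind := (@vN_ind R G S D).

Lemma ext0_delta (d : D) : l2_ext0 (delta R d) = delta R (val d).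
Proof.
apply: l2_ext => g; have [/(subgroupP D)[d' ->]|Sg] := boolP (S g).
  by rewrite l2_ext0_val /= (inj_eq val_inj).
rewrite l2_ext0_out//=; case: eqP => // gd.
by move: Sg; rewrite gd subgroup_val.
Qed.

(* With q the projection onto the closure of the range of a on l^2(D)^n, take
   c = 1 - q. *)
Lemma vN_flat : equationally_flat ind.
Proof.
(* Removing duplicates from [ms] ensures that a family v supported at one m contributes exactly the
   column of m. *)
move=> n K b a ms ba0; pose L (w : 'I_n -> l2D) :=
  exists v : K -> l2D, forall i, w i = \sum_(m <- undup ms) a i m (v m).
have [|w w' [v vw] [v' vw']|z w [v vw]|q [qcl qid qcomm]] := @projection_matrix R D n L.
- by exists (fun=> 0) => i; rewrite big1// => m _; rewrite raddf0.
- exists (fun m => v m + v' m) => i; rewrite -[LHS]/(w i + w' i) vw vw' -big_split.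
  by apply: eq_bigr => m _; rewrite raddfD.
- exists (fun m => z *: v m) => i; rewrite -[LHS]/(z *: w i) vw scaler_sumr.
  by apply: eq_bigr => m _; rewrite linearZ.
(* The entries of a are in N(D), so the range of a is invariant under right translations and q
   commutes with them. *)
have Lrtrans d w : L w -> L (fun i => rtrans d (w i)).
  move=> [v vw]; exists (fun m => rtrans d (v m)) => i; rewrite vw raddf_sum.
  by apply: eq_bigr => m _; rewrite vN_rtrans.
have q_rtrans i j d x : q i j (rtrans d x) = rtrans d (q i j x).
  apply: (qcomm (rtrans d) (rtrans d^-1%g)); [exact: l2norm_rtrans| |exact: Lrtrans|exact: Lrtrans].
  by apply: isometry_adjoint; [exact: l2norm_rtrans|exact: rtransK].
pose Q i j : vN R D := VN (rtrans_weak_closure (q_rtrans i j)).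
exists (fun l i => (l == i)%:R - Q l i); split=> [i|l m mms]; last first.
  have -> : \sum_i ((l == i)%:R - Q l i) * a i m = a l m - \sum_i Q l i * a i m.
    under eq_bigr do rewrite mulrBl.
    rewrite sumrB (bigD1 l)//= eqxx mul1r big1 ?addr0// => i.
    by rewrite eq_sym => /negPf ->; rewrite mul0r.
  apply/eqP; rewrite subr_eq0; apply/eqP/vN_ext => x; rewrite vN_sumE.
  have Lw : L (fun i => a i m x).
    exists (fun m' => if m' == m then x else 0) => i.
    rewrite (bigD1_seq m) ?undup_uniq ?mem_undup//= eqxx big1 ?addr0// => m' /negPf->.
    by rewrite raddf0.
  by rewrite -(qid _ Lw l).
have -> : \sum_l b l * ind ((l == i)%:R - Q l i) = b i - \sum_l b l * ind (Q l i).
  under eq_bigr do rewrite raddfB mulrBr.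
  rewrite sumrB (bigD1 i)//= eqxx rmorph1 mulr1 big1 ?addr0// => l /negPf ->.
  by rewrite raddf0 mulr0.
suff -> : \sum_l b l * ind (Q l i) = 0 by rewrite subr0.
apply: vN_delta1_ext; apply: l2_ext => h; apply: normc_small => e e0.
(* The projection q v is the i-th column of q applied to [delta R 1]. It is close to some w in the
   range of a, which b kills, so b q v is small; N below is the sum of bounds for the entries of
   b. *)
pose v j := if j == i then delta R (1%g : D) else 0.
have Mb l : exists M : R, 0 < M /\ forall x g, normc (b l x g) <= M * l2norm x.
  by have [M M0 MP] := bop_coord_bounded (b l); exists M.
have [M MP] := choice Mb; pose N := \sum_l M l.
have N0 : 0 < N + 1.
  by rewrite ltr_wpDl//; apply: sumr_ge0 => l _; rewrite ltW//; case: (MP l).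
have [w [u wu] qw] := qcl v _ (divr_gt0 e0 N0).
have bw0 : \sum_l b l (l2_ext0 (w l)) = 0.
  under eq_bigr do rewrite wu !raddf_sum.
  rewrite exchange_big /= big_seq big1// => m; rewrite mem_undup => /ba0 bam0.
  transitivity ((0 : vN R G) (l2_ext0 (u m))); last by [].
  rewrite -bam0 vN_sumE; apply: eq_bigr => l _.
  by rewrite vNE vN_ind_ext0.
have -> : (\sum_l b l * ind (Q l i)) (delta R 1%g) h =
    \sum_l b l (l2_ext0 (Q l i (delta R 1%g) - w l)) h.
  transitivity ((\sum_l b l * ind (Q l i)) (delta R 1%g) h - (\sum_l b l (l2_ext0 (w l))) h).
    by rewrite bw0 l2E subr0.
  rewrite vN_sumE !l2_sumE -sumrB; apply: eq_bigr => l _.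
  have -> : delta R (1%g : G) = l2_ext0 (delta R (1%g : D)) by rewrite ext0_delta val1.
  rewrite vNE vN_ind_ext0; symmetry; transitivity (b l (l2_ext0 (Q l i (delta R 1%g)) - l2_ext0 (w l)) h).
    by congr (b l _ h); exact: raddfB.
  by rewrite bopB.
apply: (@le_trans _ _ (\sum_l M l * (e / (N + 1)))); last first.
  by rewrite -mulr_suml -/N mulrCA ger_pMr// ler_pdivrMr// mul1r lerDl.
have le_sum (F : 'I_n -> C) (f : 'I_n -> R) : (forall l, normc (F l) <= f l) ->
    normc (\sum_l F l) <= \sum_l f l.
  move=> Ff; elim/big_ind2: _ => [|z c z' c' zc zc'|l _]; rewrite ?Normc.normc0//.
  by apply: le_trans (le_normcD _ _) _; exact: lerD.
apply: le_sum => l; have [M0 {}MP] := MP l.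
apply: le_trans (MP _ _) _; rewrite ler_pM2l// l2norm_ext0 ltW//.
have -> : Q l i (delta R 1%g) = \sum_j q l j (v j); last exact: qw.
rewrite (bigD1 i)//= [X in _ + X]big1 => [|j /negPf ji].
  by rewrite addr0 /v eqxx.
by rewrite /v ji raddf0.
Qed.

End Flatness.

(** * Induction and restriction *)

Section TensLift.
Variables (A B : pzRingType) (phi : {rmorphism A -> B}) (M : lmodType A) (V : zmodType).

Lemma tens_lift_spec (f : B -> M -> V) :
  (forall b c m, f (b + c) m = f b m + f c m) ->
  (forall b m n, f b (m + n) = f b m + f b n) ->
  (forall b a m, f (b * phi a) m = f b (a *: m)) ->
  exists F : {additive tens phi M -> V}, forall b m, F (pure phi b m) = f b m.
Proof.
move=> fDl fDr fmid.
pose Fa := GRing.isZmodMorphism.Build _ _ _ (tens_liftB fDl fDr fmid).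
exists (HB.pack_for {additive tens phi M -> V} (tens_lift f) Fa) => b m.
exact: tens_lift_pure.
Qed.

End TensLift.

Section Transitivity.
Variables (A B C : pzRingType) (phi : {rmorphism A -> B}) (psi : {rmorphism B -> C})
  (M : lmodType A).

(** One direction of the transitivity of extension of scalars. By [tens_transP] the elements c (x)
    (1 (x) m) generate, so these values determine F. *)
Lemma tens_trans_inv : exists F : {additive tens psi (tens phi M) -> tens (psi \o phi) M},
  forall c m, F (pure psi c (pure phi 1 m)) = pure (psi \o phi) c m.
Proof.
have inner c : exists F : {additive tens phi M -> tens (psi \o phi) M},
    forall b m, F (pure phi b m) = pure (psi \o phi) (c * psi b) m.
  apply: tens_lift_spec => *.
  - by rewrite rmorphD mulrDr pureDl.
  - by rewrite pureDr.
  - by rewrite rmorphM mulrA -[psi (phi _)]/((psi \o phi) _) pure_mid.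
have [f fE] := choice inner.
have [|||F FE] := @tens_lift_spec _ _ psi (tens phi M) (tens (psi \o phi) M) (fun c u => f c u).
- move=> b c; apply: (@tens_ext _ _ phi _ _ (f (b + c)) (fun u => f b u + f c u)).
  + exact: raddfB.
  + by move=> x y; rewrite !raddfB opprD addrACA.
  + by move=> d m; rewrite !fE mulrDl pureDl.
- by move=> b m n; rewrite raddfD.
- move=> c b; apply: (@tens_ext _ _ phi _ _ (f (c * psi b)) (fun u => f c (b *: u))).
  + exact: raddfB.
  + by move=> x y; rewrite scalerBr raddfB.
  + by move=> d m; rewrite tens_scaleE !fE rmorphM mulrA.
by exists F => c m; rewrite FE fE rmorph1 mulr1.
Qed.

Lemma tens_transP (z : tens psi (tens phi M)) :
  exists s : seq (C * M), z = \sum_(p <- s) pure psi p.1 (pure phi 1 p.2).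
Proof.
elim/tens_ind: z.
- by exists [::]; rewrite big_nil.
- by move=> _ _ [s ->] [s' ->]; exists (s ++ s'); rewrite big_cat.
- move=> _ [s ->]; exists [seq (- p.1, p.2) | p <- s].
  by rewrite big_map -sumrN; apply: eq_bigr => p _; rewrite pureNl.
- move=> c u; have [s ->] := tens_sumP u.
  exists [seq (c * psi p.1, p.2) | p <- s].
  rewrite big_map pure_sumr; apply: eq_bigr => p _ /=.
  by rewrite pure_mid tens_scaleE mulr1.
Qed.

End Transitivity.

Section FlatInduction.
Variables (A B M N : pzRingType) (incl : {rmorphism A -> B}) (ind : {rmorphism M -> N})
  (p : {rmorphism A -> M}) (q : {rmorphism B -> N}).
Hypothesis indp : forall a, ind (p a) = q (incl a).

Lemma induce_tens (X : lmodType A) :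
  exists F : {additive tens p X -> tens q (tens incl X)},
  forall T m, F (pure p T m) = pure q (ind T) (pure incl 1 m).
Proof.
apply: tens_lift_spec => *.
- by rewrite raddfD pureDl.
- by rewrite !pureDr.
- by rewrite rmorphM /= indp pure_mid tens_scaleE mulr1 -[incl _ in LHS]mul1r pure_mid.
Qed.

(** The cycle z is moved to t in N (x)_A Z and rewritten as sum_j b_j (x) x_j by [tens_map_eq0].
    Flatness yields cycles w_l = sum_j c_lj (x) x_j over M; if u_l bounds w_l, then sum_l b_l f(u_l)
    bounds z, as b = b c. *)
Lemma flat_exact_below (Z : chain_complex A) i : equationally_flat ind ->
  exact_below (ext_complex p Z) i ->
  exact_below (ext_complex q (ext_complex incl Z)) i.
Proof.
move=> flat ex z bz; have [s zE] := tens_transP z.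
have [k kE] := tens_trans_inv incl q (Z (i - 1 - 1)).
pose phi : {rmorphism A -> N} := (q \o incl).
pose t := \sum_(r <- s) pure phi r.1 r.2.
have bt : tens_map phi (bd Z (i - 1)) t = 0.
  pose F := tens_map q (tens_map incl (bd Z (i - 1))).
  have Fz : F z = 0 := bz.
  rewrite -[RHS](raddf0 k) -Fz zE [X in k X](raddf_sum F) (raddf_sum k) raddf_sum.
  apply: eq_bigr => r _.
  apply: etrans (tens_map_pure _ _ _ _) _; rewrite -kE; congr (k _); symmetry.
  apply: etrans (tens_map_pure _ _ _ _) _; congr (pure _ _ _).
  exact: tens_map_pure.
have [f fE] := induce_tens (Z i); have [f' f'E] := induce_tens (Z (i - 1)).
have fb u : f' (tens_map p (bd Z i) u) = tens_map q (tens_map incl (bd Z i)) (f u).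
  move: u; apply: (@tens_ext _ _ _ _ _ (fun u => f' (tens_map p (bd Z i) u))
    (fun u => tens_map q (tens_map incl (bd Z i)) (f u))).
  - by move=> x y; rewrite !raddfB.
  - by move=> x y; rewrite !raddfB.
  - move=> T m; rewrite [X in f' X]tens_map_pure fE f'E; symmetry.
    apply: etrans (tens_map_pure _ _ _ _) _; congr (pure _ _ _).
    exact: tens_map_pure.
have [n [b [x [a [ms [tE bdx ba]]]]]] := tens_map_eq0 bt.
have [|c [bE ca]] := flat n _ b (fun i m => p (a i m)) ms.
  move=> m mms; rewrite -[RHS](ba m mms); apply: eq_bigr => j _.
  by rewrite indp.
pose w l : tens p (Z (i - 1)) := \sum_j pure p (c l j) (x j).
have bw l : exists u, tens_map p (bd Z i) u = w l.
  apply: ex; rewrite -[LHS]/(tens_map p (bd Z (i - 1)) (w l)) /w raddf_sum.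
  transitivity (\sum_(m <- ms) pure p (\sum_j c l j * p (a j m)) m).
    under eq_bigr do rewrite /= tens_map_pure bdx pure_sumr.
    rewrite exchange_big; apply: eq_bigr => m _; rewrite pure_suml.
    by apply: eq_bigr => j _; rewrite pure_mid.
  by rewrite big_seq big1// => m /ca ->; rewrite pure0l.
have [u uE] := choice bw.
exists (\sum_l b l *: f (u l)); rewrite raddf_sum /=.
under eq_bigr do rewrite linearZ /= -fb uE /w raddf_sum scaler_sumr.
rewrite exchange_big /=.
transitivity (\sum_j pure q (b j) (pure incl 1 (x j))).
  apply: eq_bigr => j _; rewrite bE pure_suml; apply: eq_bigr => l _.
  by rewrite f'E tens_scaleE.
have [g gE] : exists F : {additive tens phi (Z (i - 1)) -> tens q (tens incl (Z (i - 1)))},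
    forall T m, F (pure phi T m) = pure q T (pure incl 1 m).
  apply: tens_lift_spec => *.
  - by rewrite pureDl.
  - by rewrite !pureDr.
  - by rewrite /phi /= pure_mid tens_scaleE mulr1 -[incl _ in LHS]mul1r pure_mid.
transitivity (g t).
  by rewrite tE raddf_sum; apply: eq_bigr => j _; rewrite gE.
by rewrite zE /t raddf_sum; apply: eq_bigr => r _; rewrite gE.
Qed.

End FlatInduction.

(** * Restriction as a retract, for abstract rings *)

Section FiniteIndexRestriction.
Variables (A B M N : pzRingType) (incl : {rmorphism A -> B}) (ind : {rmorphism M -> N})
  (p : {rmorphism A -> M}) (q : {rmorphism B -> N}).
Variables (E : {additive N -> M}) (I : Type) (F : seq I) (u : I -> N) (v : I -> B).
Hypothesis indp : forall a, ind (p a) = q (incl a).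
Hypothesis E_indMl : forall T U, E (ind T * U) = T * E U.
Hypothesis balanced : forall (X : lmodType B) T b (x : X),
  \sum_(t <- F) pure p (E (T * q b * u t)) (v t *: x : restr incl X) =
  \sum_(t <- F) pure p (E (T * u t)) (v t *: (b *: x) : restr incl X).
Hypothesis retraction : forall (X : lmodType B) T (x : X),
  \sum_(t <- F) pure p (T * E (u t)) (v t *: x : restr incl X) =
  pure p T (x : restr incl X).

Let induce (X : lmodType B) :
  exists P : {additive tens p (restr incl X) -> tens q X},
  forall T x, P (pure p T x) = pure q (ind T) (x : X).
Proof.
apply: tens_lift_spec => [b c m|b m n|b a m].
- by rewrite raddfD pureDl.
- by rewrite -pureDr.
- by rewrite rmorphM /= indp pure_mid.
Qed.

Let restrict (X : lmodType B) :
  exists P : {additive tens q X -> tens p (restr incl X)},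
  forall T x, P (pure q T x) = \sum_(t <- F) pure p (E (T * u t)) (v t *: x : restr incl X).
Proof.
apply: tens_lift_spec => [b c m|b m n|b a m].
- rewrite -big_split; apply: eq_bigr => t _.
  by rewrite mulrDl raddfD pureDl.
- rewrite -big_split; apply: eq_bigr => t _.
  by rewrite scalerDr; exact: pureDr.
- exact: balanced.
Qed.

(** The maps P and Q commute with the boundaries and Q' P is the identity: if y bounds P z, then Q y
    bounds z. *)
Lemma res_exact_below (X : chain_complex B) i :
  exact_below (ext_complex q X) i -> exact_below (ext_complex p (res_complex incl X)) i.
Proof.
move=> ex z bz.
have [P0 P0E] := induce (X (i - 1 - 1)); have [P PE] := induce (X (i - 1)).
have [Q QE] := restrict (X i); have [Q' Q'E] := restrict (X (i - 1)).
have Pb w : tens_map q (bd X (i - 1)) (P w) =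
    P0 (tens_map p (bd (res_complex incl X) (i - 1)) w).
  move: w; apply: (@tens_additive_ext _ _ _ _ _
    (tens_map q (bd X (i - 1)) \o P)
    (P0 \o tens_map p (bd (res_complex incl X) (i - 1)))) => T x /=.
  rewrite PE; apply: etrans (tens_map_pure _ _ _ _) _; symmetry.
  by apply: etrans (P0E _ _); congr (P0 _); exact: tens_map_pure.
have Qb w : tens_map p (bd (res_complex incl X) i) (Q w) = Q' (tens_map q (bd X i) w).
  move: w; apply: (@tens_additive_ext _ _ _ _ _
    (tens_map p (bd (res_complex incl X) i) \o Q)
    (Q' \o tens_map q (bd X i))) => T x /=.
  rewrite QE; symmetry; transitivity (Q' (pure q T (bd X i x))).
    by congr (Q' _); exact: tens_map_pure.
  rewrite Q'E raddf_sum; apply: eq_bigr => t _; symmetry.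
  apply: etrans (tens_map_pure _ _ _ _) _; congr (pure _ _ _).
  exact: linearZ.
have QP w : Q' (P w) = w.
  move: w; apply: (@tens_additive_ext _ _ _ _ _ (Q' \o P) idfun) => T x /=.
  rewrite PE Q'E -[RHS]retraction; apply: eq_bigr => t _.
  by rewrite E_indMl.
have [|y yE] := ex (P z).
  by apply: etrans (Pb z) _; rewrite [X in P0 X]bz raddf0.
exists (Q y); apply: etrans (Qb y) _; rewrite -[RHS]QP; congr (Q' _).
exact: yE.
Qed.

End FiniteIndexRestriction.

Section FiniteIndex.
Variables (R : realType) (G : groupType) (S : pred G) (D : subGroupType S).
Local Notation incl := (@gr_incl G S D).
Local Notation rep := (coset_rep S).

(** Right multiplication by g permutes the right cosets, hence t |-> rep (t g) permutes the
    representatives. *)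
Lemma coset_rep_mulK t g : rep (rep (t * g) * g^-1)%g = rep t.
Proof.
apply: (coset_rep_eq D); rewrite -mulgA -invgM; exact: (coset_repP D).
Qed.

(** Finiteness of the index is expressed by left cosets, the representatives belong to right cosets;
    inversion exchanges the two. *)
Lemma finite_coset_reps : finite_index S -> finite_set [set t | rep t = t]%classic.
Proof.
move=> /(finite_image (fun X : set G => rep (xget 1%g X)^-1%g)); apply: sub_finite_set.
move=> t /= rt; exists [set h | S (t * h)%g]%classic.
  by exists t^-1%g => //; apply/seteqP; split=> h; rewrite /= invgK.
rewrite -[RHS]rt; apply: (coset_rep_eq D).
have : S (t * xget 1%g [set h | S (t * h)%g]%classic)%g.
  (* The default value 1 of [xget] is never taken, as the coset contains t^-1. *)
  case: xgetP => [_ -> //|] /(_ t^-1%g) /=; rewrite mulgV => /(_ _)[].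
  exact: (subgroup1 D).
by move=> /(subgroupV D); rewrite invgM.
Qed.

Lemma vN_acyclic_res n (X : chain_complex (grpring int G)) :
  finite_index S -> vN_acyclic R n X -> vN_acyclic R n (res_complex incl X).
Proof.
move=> /finite_coset_reps finF /vN_acyclicP ex; apply/vN_acyclicP => i /ex exi.
pose F := fset_set [set t | rep t = t]%classic.
have inF t : (t \in F) = (rep t == t).
  by rewrite in_fset_set//; apply/idP/eqP; rewrite inE.
refine (@res_exact_below _ _ _ _ incl (@vN_ind R G S D) (@vN_of R D) (@vN_of R G)
  (@vN_exp R G S D) _ F (fun t => vN_unit R t^-1%g) (@gr_unit int G) _ _ _ _ X i exi).
- exact: vN_ind_of.
- exact: vN_exp_indMl.
- move=> Y T b y; move: b.
  pose tm U t z := pure (@vN_of R D) (vN_exp D (U * vN_unit R t^-1%g))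
    (gr_unit int t *: z : restr incl Y).
  apply: (@grpring_ext _ _ (fun b => \sum_(t <- F) tm (T * vN_of R b) t y)
    (fun b => \sum_(t <- F) tm T t (b *: y))) => [b c|b c|g].
  + rewrite -sumrB; apply: eq_bigr => t _.
    by rewrite /tm raddfB mulrBr mulrBl raddfB pureDl pureNl.
  + rewrite -sumrB; apply: eq_bigr => t _.
    rewrite /tm scalerBl scalerBr; apply: etrans (pureDr _ _ _ _) _.
    by congr (_ + _); exact: pureNr.
  (* After this permutation the terms match: with s = rep (t g) and t g = d s, one has T g s^-1 = T
     t^-1 d, and d passes through E and across the tensor sign, giving d s y = t (g y). *)
  transitivity (\sum_(t <- [seq rep (t * g)%g | t <- F]) tm (T * vN_of R (gr_unit int g)) t y).
    apply: perm_big; apply: uniq_perm; rewrite ?fset_uniq//.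
      rewrite map_inj_in_uniq ?fset_uniq// => t t'; rewrite !inF => /eqP rt /eqP rt' e.
      by rewrite -rt -rt' -(coset_rep_mulK t g) e coset_rep_mulK.
    move=> t; apply/idP/mapP => [|[t' _ ->]]; rewrite inF; last by rewrite (coset_rep_idem D).
    move=> /eqP rt; exists (rep (t * g^-1)%g); first by rewrite inF (coset_rep_idem D).
    by rewrite -{2}(invgK g) coset_rep_mulK.
  rewrite big_map; apply: eq_bigr => t _; rewrite /tm.
  set s := rep (t * g)%g.
  have : S (t * g * s^-1)%g.
    by have /(subgroupV D) := coset_repP D (t * g)%g; rewrite invgM invgK.
  move=> /(subgroupP D)[d dE].
  have -> : T * vN_of R (gr_unit int g) * vN_unit R s^-1%g =
      T * vN_unit R t^-1%g * vN_unit R (val d).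
    by rewrite vN_of_unit -!mulrA -!vN_unitM -dE -mulgA mulKg.
  rewrite vN_exp_unitMr -(vN_of_unit R d) pure_mid; congr (pure _ _ _).
  rewrite -[LHS]/(incl (gr_unit int d) *: (gr_unit int s *: y)) gr_incl_unit.
  by rewrite !scalerA -!gr_unitM -dE mulgVK.
(* E (t^-1) vanishes unless t is in D, so only t = rep 1 contributes. This may be some d other than
   1, but d^-1 (x) d y = 1 (x) y. *)
- move=> Y T y; have r1 : rep 1%g \in F by rewrite inF (coset_rep_idem D).
  rewrite (bigD1_seq (rep 1%g)) ?fset_uniq//= [X in _ + X]big_seq_cond big1 ?addr0.
    have : S (rep 1%g) by have := coset_repP D 1%g; rewrite invg1 mulg1.
    move=> /(subgroupP D)[d ->].
    rewrite -valVg -[vN_unit R (val _)]mul1r vN_exp_unitMr vN_exp1 mul1r -(vN_of_unit R d^-1%g) pure_mid.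
    congr (pure _ _ _).
    rewrite -[LHS]/(incl (gr_unit int d^-1%g) *: (gr_unit int (val d) *: y)) gr_incl_unit.
    by rewrite scalerA -gr_unitM -valM mulVg val1 gr_unit1 scale1r.
  move=> t /andP[]; rewrite inF => /eqP rt t1.
  rewrite vN_exp_unit ?mulr0 ?pure0l//; apply: contra t1 => /(subgroupV D).
  by rewrite invgK -{2}rt => St; apply/eqP/(coset_rep_eq D); rewrite invg1 mulg1.
Qed.

Lemma vN_acyclic_ind n (Z : chain_complex (grpring int D)) :
  vN_acyclic R n Z -> vN_acyclic R n (ext_complex incl Z).
Proof.
move=> /vN_acyclicP ex; apply/vN_acyclicP => i /ex.
apply: (flat_exact_below (ind := @vN_ind R G S D)) => //.
- exact: vN_ind_of.
- exact: vN_flat.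
Qed.

End FiniteIndex.

Theorem proposition4p5 (R : realType) :
  equivariantly_bootstrappable (@vN_acyclic R) /\ B_res (@vN_acyclic R).
Proof.
split; last by move=> G S D n X; exact: vN_acyclic_res.
split.
- move=> G n X Y XY /vN_acyclicP ex; apply/vN_acyclicP => i /ex.
  exact: exact_below_iso.
- move=> G X m cX m0; apply/vN_acyclicP => i im; apply: exact_below_concentrated cX _.
  (* For integers m < 0 means m + 1 <= 0, so every i in the range is at most 0. *)
  by apply: le_trans im _; rewrite lezD1.
- move=> G n X; split=> /vN_acyclicP ex; apply/vN_acyclicP => i ni.
    by apply: (proj1 (exact_below_susp (@vN_of R G) X i)); apply: ex; rewrite lerBlDr.
  have iE : i = (i + 1) - 1 by rewrite addrK.
  by rewrite iE; apply: (proj2 (exact_below_susp (@vN_of R G) X (i + 1))); apply: ex; rewrite lerD2r.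
- move=> G n X Y f /vN_acyclicP exX /vN_acyclicP exY; apply/vN_acyclicP => i ni.
  apply: exact_below_cone; last exact: exY.
  by apply: exX; rewrite subrK lerBlDr.
- by move=> G S D n Z; exact: vN_acyclic_ind.
Qed.
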